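(* For any integers $d$ and $k$, there exists a cactus $CT$ with girth at least $k$ and cycle-distance at least $d$ such that $\chi_g(CT) = 5$.
   Context: All graphs are simple, finite and undirected. The length of a path or cycle is its number of edges. The girth of a graph is the length of its shortest cycle. A cactus is a graph in which every edge belongs to at most one cycle. The cycle-distance of a cactus is the minimum length of a path between two vertices belonging to different cycles. The coloring game on a graph $G$ with a set of $k$ colors: Alice and Bob alternately color an uncolored vertex of $G$ with a color from the set so that the partial coloring remains proper (adjacent vertices get different colors); Alice wins if the whole graph gets colored, Bob wins otherwise. The game chromatic number $\chi_g(G)$ is the smallest $k$ such that Alice has a winning strategy with $k$ colors. *)

(* Defs.v *)
(* A graph is a symmetric irreflexive relation e on a finType. *)
From HB Require Import structures.
From mathcomp Require Import all_boot all_order all_algebra.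

Set Implicit Arguments.
Unset Strict Implicit.
Unset Printing Implicit Defensive.

Definition simple_graph (T : finType) (e : rel T) : Prop :=
  symmetric e /\ irreflexive e.

(* A cycle is given by the sequence of its vertices in cyclic order. Sequences
   differing by rotation or reversal describe the same cycle, so cycles are
   compared through their edge sets. *)
Definition is_cycle (T : finType) (e : rel T) (c : seq T) : bool :=
  (2 < size c) && (cycle e c && uniq c).

Definition cycle_edges (T : finType) (c : seq T) : {set {set T}} :=
  [set [set x; next c x] | x in c].

(* Connectedness is not required. *)
Definition cactus (T : finType) (e : rel T) : Prop :=
  forall (x y : T) (c1 c2 : seq T),
    e x y -> is_cycle e c1 -> is_cycle e c2 ->
    [set x; y] \in cycle_edges c1 -> [set x; y] \in cycle_edges c2 ->
    cycle_edges c1 = cycle_edges c2.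

(* Minimum of a set of naturals; None stands for +oo, the minimum of the empty
   set. *)
Definition is_minimum (P : nat -> Prop) (m : option nat) : Prop :=
  if m is Some n then P n /\ (forall j : nat, P j -> n <= j)
  else forall j : nat, ~ P j.

Definition at_least (m : option nat) (z : int) : Prop :=
  if m is Some n then (z <= n%:Z)%R else True.

Definition is_girth (T : finType) (e : rel T) : option nat -> Prop :=
  is_minimum (fun n => exists2 c : seq T, is_cycle e c & size c = n).

(* x :: p is the vertex sequence of the path, so size p is its number of edges;
   two distinct cycles with a common vertex give a path of length 0. *)
Definition is_cycle_distance (T : finType) (e : rel T) : option nat -> Prop :=
  is_minimum (fun n => exists (c1 c2 : seq T) (x : T) (p : seq T),
    [/\ is_cycle e c1 /\ is_cycle e c2,
        cycle_edges c1 <> cycle_edges c2,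
        x \in c1 /\ last x p \in c2,
        path e x p /\ uniq (x :: p)
      & size p = n]).

Definition partial_coloring (T : finType) (k : nat) : Type :=
  {ffun T -> option 'I_k}.

Definition proper (T : finType) (e : rel T) (k : nat)
    (f : partial_coloring T k) : Prop :=
  forall (x y : T) (a b : 'I_k),
    e x y -> f x = Some a -> f y = Some b -> a <> b.

Definition legal_move (T : finType) (e : rel T) (k : nat)
    (f f' : partial_coloring T k) : Prop :=
  exists (v : T) (a : 'I_k),
    [/\ f v = None, f' = [ffun x => if x == v then Some a else f x]
      & proper e f'].

Definition complete (T : finType) (k : nat) (f : partial_coloring T k) : Prop :=
  forall x : T, f x <> None.

(* A strategy of Alice sends the current coloring to the one after her move.
   The boolean is true when it is Alice's turn. *)
Definition strategy (T : finType) (k : nat) : Type :=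
  partial_coloring T k -> partial_coloring T k.

Definition step (T : finType) (e : rel T) (k : nat) (s : strategy T k)
    (alice : bool) (f f' : partial_coloring T k) : Prop :=
  legal_move e f f' /\ (alice -> f' = s f).

(* The positions met in the plays, opened by Alice, in which she follows s. *)
Inductive reached (T : finType) (e : rel T) (k : nat) (s : strategy T k) :
    bool -> partial_coloring T k -> Prop :=
| reached_start : reached e s true [ffun=> None]
| reached_step (alice : bool) (f f' : partial_coloring T k) :
    reached e s alice f -> step e s alice f f' -> reached e s (~~ alice) f'.

(* Every legal move colors a new vertex, so plays are finite: s wins when no
   play following s stops, for want of a move or because s prescribes an illegal
   one, before all vertices are colored. *)
Definition winning (T : finType) (e : rel T) (k : nat) (s : strategy T k) :
    Prop :=
  forall (alice : bool) (f : partial_coloring T k),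
    reached e s alice f -> (forall f', ~ step e s alice f f') -> complete f.

Definition alice_wins (T : finType) (e : rel T) (k : nat) : Prop :=
  exists s : strategy T k, winning e s.

Definition is_game_chromatic_number (T : finType) (e : rel T) (k : nat) : Prop :=
  is_minimum (alice_wins e) (Some k).

(* Main.v *)
Require Import Defs.
From HB Require Import structures.
From mathcomp Require Import all_boot all_order all_algebra.
From mathcomp Require Import zify.
From Stdlib Require Import Classical ClassicalEpsilon.

(* The graph is a tree-like arrangement of "lollipops", each made of a handle of
   l vertices leading to a cycle of odd length n: every vertex of a lollipop
   carries many further lollipops, attached by the free ends of their handles,
   three levels deep.

   Alice wins with 5 colors by the activation strategy on the forest left by
   deleting one edge of each cycle: when a vertex has to be colored, at most
   three of its neighbors in the forest are colored, and the deleted edges form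
   a matching.

   Bob wins with at most 4 colors thanks to a parity invariant. Let S be a set of
   2 colors, and consider a path of uncolored vertices whose first vertex sees
   both colors of S, and whose last one sees both colors of S (resp. of the
   complement of S) if the path has evenly (resp. oddly) many vertices. Any color
   put by Alice on the path makes one of the two remaining pieces a shorter path
   that Bob completes into one of the same kind by coloring a single pendant
   vertex. In an odd cycle the two ways around have different parities, so one of
   them always suits Bob. *)

Set Implicit Arguments.
Unset Strict Implicit.
Unset Printing Implicit Defensive.

(** * Winning positions of Bob *)

Section Moves.
Variables (T : finType) (e : rel T) (k : nat).
Implicit Types (f : partial_coloring T k) (v w : T) (c : nat).

Definition colored f : {set T} := [set x | f x != None].

Inductive bob_wins : bool -> partial_coloring T k -> Prop :=
| bob_wins_dead alice f v :
    f v = None -> (forall a, exists2 w, e v w & f w = Some a) ->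
    bob_wins alice f
| bob_wins_bob f f' : legal_move e f f' -> bob_wins true f' -> bob_wins false f
| bob_wins_alice f v :
    f v = None -> (forall f', legal_move e f f' -> bob_wins false f') ->
    bob_wins true f.

Lemma legal_moveP f f' : legal_move e f f' ->
  exists v a, [/\ f v = None, f' v = Some a, forall x, x != v -> f' x = f x
    & Defs.proper e f'].
Proof.
move=> [v [a [fv -> pf']]]; exists v, a; split=> // [|x /negPf xv].
  by rewrite ffunE eqxx.
by rewrite ffunE xv.
Qed.

Lemma legal_move_Some f f' x a : legal_move e f f' -> f x = Some a ->
  f' x = Some a.
Proof.
move=> /legal_moveP[v [b [fv _ eqf _]]] fx; rewrite eqf //; apply/eqP => xv.
by rewrite xv fv in fx.
Qed.

Lemma card_colored_legal f f' : legal_move e f f' ->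
  #|colored f'| = #|colored f|.+1.
Proof.
move=> /legal_moveP[v [a [fv f'v eqf _]]].
have -> : colored f' = v |: colored f.
  by apply/setP=> x; rewrite !inE; case: (x =P v) => [->|/eqP/eqf-> //]; rewrite f'v.
by rewrite cardsU1 inE fv.
Qed.

Lemma winning_not_bob_wins s alice f :
  winning e s -> reached e s alice f -> bob_wins alice f -> False.
Proof.
move=> ws rf bf; elim: bf rf => {alice f}.
- move=> alice f v.
  have [m] := ubnP (#|T| - #|colored f|); elim: m alice f => // m IHm alice f.
  move=> lt_m fv dead_v rf; apply: (ws _ _ rf) (fv) => f' st.
  have [lf _] := st; have cf := card_colored_legal lf.
  have f'v : f' v = None.
    case f'v: (f' v) => [a|//]; have [w vw fw] := dead_v a.
    have [_ [_ [_ _ _ pf']]] := legal_moveP lf.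
    by have := pf' _ _ _ _ vw f'v (legal_move_Some lf fw).
  apply: (IHm _ f' _ f'v _ (reached_step rf st)).
    by have := max_card [in colored f']; rewrite cf; lia.
  by move=> a; have [w vw fw] := dead_v a; exists w => //; apply: legal_move_Some fw.
- move=> f f' lf _ IH rf; apply: IH.
  by apply: (reached_step (alice := false)) rf _; split.
- move=> f v fv _ IH rf; apply: (ws _ _ rf) (fv) => f' st.
  by apply: (IH f' st.1); apply: (reached_step (alice := true)) rf st.
Qed.

(* The colors c >= k do not exist and count as seen by every vertex, so that one
   strategy serves for all k <= 4. *)
Definition sees f v c : Prop :=
  k <= c \/ exists w (a : 'I_k), [/\ e v w, f w = Some a & a = c :> nat].

Lemma sees_legal f f' v c : legal_move e f f' -> sees f v c -> sees f' v c.
Proof.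
move=> lf [?|[w [a [vw fw ac]]]]; [by left|right; exists w, a; split=> //].
exact: legal_move_Some fw.
Qed.

Lemma sees_Some f v w a : e v w -> f w = Some a -> sees f v a.
Proof. by move=> vw fw; right; exists w, a. Qed.

Hypothesis k4 : k <= 4.

Lemma bob_wins_sees_all alice f v : f v = None ->
  (forall c, c < 4 -> sees f v c) -> bob_wins alice f.
Proof.
move=> fv sv; apply: (bob_wins_dead _ fv) => a.
case: (sv a); first by have := ltn_ord a; lia.
  by have := ltn_ord a; lia.
by move=> [w [b [vw fw ab]]]; exists w => //; rewrite fw; congr Some; apply: val_inj.
Qed.

Lemma alice_turn f x : f x = None ->
  (forall f' v (a : 'I_k), legal_move e f f' -> f v = None -> f' v = Some a ->
     a < 4 -> (forall x, x <> v -> f' x = f x) -> ~ sees f v a ->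
     (forall u, e u v -> sees f' u a) -> bob_wins false f') ->
  bob_wins true f.
Proof.
move=> fx H; apply: (bob_wins_alice fx) => f' lf.
have [v [a [fv f'v eqf pf']]] := legal_moveP lf.
apply: (H f' v a) => //.
- by have := ltn_ord a; lia.
- by move=> y /eqP/eqf.
- move=> [|[w [b [vw fw ab]]]]; first by have := ltn_ord a; lia.
  apply: (pf' _ _ _ _ vw f'v (legal_move_Some lf fw)).
  exact/esym/val_inj.
- by move=> u uv; apply: sees_Some uv f'v.
Qed.

End Moves.

(** * Bob's strategy with at most four colors *)

Definition balanced (S : nat -> bool) : Prop :=
  (forall b, exists2 c, c < 4 & S c = b) /\
  (forall c, c < 4 -> exists2 c', c' < 4 &
     S c' = S c /\ forall x, x < 4 -> S x = S c -> x = c \/ x = c').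

Definition pair2 (a b c : nat) : bool := (c == a) || (c == b).

Lemma pair2P (a b x : nat) : pair2 a b x -> x = a \/ x = b.
Proof. by case/orP => /eqP; auto. Qed.

Lemma balanced_addb S b : balanced S -> balanced (fun c => S c (+) b).
Proof.
move=> [ex pr]; split=> [b'|c /pr[c' c'4 [eqS uq]]].
  by have [c c4 Sc] := ex (b' (+) b); exists c => //; rewrite Sc addbK.
exists c' => //; split=> [|x x4 /addIb]; [by rewrite eqS|exact: uq].
Qed.

Lemma balanced_pair2 a b : a < 4 -> b < 4 -> a <> b -> balanced (pair2 a b).
Proof.
move=> a4 b4 ab; split=> [s|c].
  suff: has (fun c => pair2 a b c == s) (iota 0 4).
    by case/hasP => c; rewrite mem_iota => ? /eqP; exists c.
  by move/eqP: ab; move: a b s a4 b4 => [|[|[|[|]]]] // [|[|[|[|]]]] // [].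
move=> c4; suff: has (fun c' => (pair2 a b c' == pair2 a b c) && all (fun x =>
    (pair2 a b x == pair2 a b c) ==> (x == c) || (x == c')) (iota 0 4)) (iota 0 4).
  case/hasP => c'; rewrite mem_iota => c'4 /andP[/eqP eqS /allP al].
  exists c' => //; split=> // x x4 /eqP Sx.
  have := al x; rewrite mem_iota => /(_ x4); rewrite Sx => /orP[]/eqP; by auto.
by move/eqP: ab; move: a b c a4 b4 c4 => [|[|[|[|]]]] // [|[|[|[|]]]] // [|[|[|[|]]]].
Qed.

Section Strategy.
Variables (T : finType) (e : rel T) (k : nat).
Implicit Types (f : partial_coloring T k) (v w : T) (c : nat) (p q u : nat -> T).
Hypotheses (k0 : 0 < k) (k4 : k <= 4) (e_sym : symmetric e)
  (e_irr : irreflexive e).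
Variables (lev : T -> nat) (K l n : nat).
Hypotheses (n_odd : odd n) (n3 : 2 < n).

Let n1_even : odd n.-1 = false.
Proof. by case: n n_odd => //= m /negbTE. Qed.

Definition upath f p m : Prop :=
  [/\ forall i, i < m -> f (p i) = None /\ lev (p i) <= 2,
      forall i j, i < m -> j < m -> p i = p j -> i = j
    & forall i, i.+1 < m -> e (p i) (p i.+1)].

Hypothesis branch : forall (D : {set T}) v, lev v <= 2 -> #|D| < K ->
  exists q, [/\ [/\ forall i, i < l + n -> lev (q i) = (lev v).+1,
        forall i j, i < l + n -> j < l + n -> q i = q j -> i = j,
        forall i, i.+1 < l + n -> e (q i) (q i.+1)
      & e (q l) (q (l + n).-1)],
    forall i, i < l + n -> q i \notin D, e v (q 0) &
    forall x, e (q 0) x -> x = v \/ x \notin D].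

Lemma legal_proper f f' : legal_move e f f' -> Defs.proper e f'.
Proof. by case/legal_moveP => ? [? []]. Qed.

Lemma mark f v c (X : {set T}) :
  Defs.proper e f -> f v = None -> lev v <= 2 -> v \in X ->
  #|colored f| + #|X| < K ->
  (forall f', legal_move e f f' -> sees e f' v c ->
     (forall x, x \in X -> f' x = f x) -> bob_wins e true f') ->
  bob_wins e false f.
Proof.
move=> pf fv lv vX ltK H.
have ltD : #|colored f :|: X| < K by apply: leq_ltn_trans ltK; rewrite cardsU leq_subr.
have [q [_ qD vq0 nq0]] := branch lv ltD.
have /qD : 0 < l + n by lia.
move: (q 0) vq0 nq0 => w vw nw; rewrite !inE negb_or negbK => /andP[/eqP fw wX].
pose a : 'I_k := insubd (Ordinal k0) c.
pose f' : partial_coloring T k := [ffun x => if x == w then Some a else f x].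
have f'w : f' w = Some a by rewrite ffunE eqxx.
have eqf x : x != w -> f' x = f x by rewrite ffunE => /negPf->.
have fnw x : e w x -> f x = None.
  by move/nw => [->//|]; rewrite !inE negb_or negbK => /andP[/eqP].
have lf : legal_move e f f'.
  exists w, a; split=> // x y b d xy.
  have [xw|xw] := eqVneq x w; have [yw|yw] := eqVneq y w.
  - by rewrite xw yw e_irr in xy.
  - by rewrite (eqf y yw) fnw // -xw.
  - by rewrite (eqf x xw) fnw // -yw e_sym.
  by rewrite !eqf //; apply: pf.
apply: (bob_wins_bob lf); apply: H => //.
  have [ck|kc] := ltnP c k; last by left.
  right; exists w, a; split=> //; by rewrite /a val_insubd ck.
by move=> x xX; apply: eqf; apply: contraNneq wX => <-.
Qed.

Definition pset p m : {set T} := [set p i | i : 'I_m].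

Lemma card_pset p m : #|pset p m| <= m.
Proof. by rewrite -[leqRHS]card_ord leq_imset_card. Qed.

Lemma mem_pset p m i : i < m -> p i \in pset p m.
Proof. by move=> im; apply/imsetP; exists (Ordinal im). Qed.

Lemma upath_sub f p m i m' : upath f p m -> i + m' <= m ->
  upath f (fun j => p (i + j)) m'.
Proof.
move=> [un inj ed] le_m; split=> [j jm|j j' jm j'm /inj|j jm].
- by apply: un; lia.
- by lia.
- by rewrite addnS; apply: ed; lia.
Qed.

Lemma upath_rev f p m : upath f p m -> upath f (fun j => p (m.-1 - j)) m.
Proof.
move=> [un inj ed]; split=> [j jm|j j' jm j'm /inj|j jm].
- by apply: un; lia.
- by lia.
- rewrite e_sym; have -> : m.-1 - j = (m.-1 - j.+1).+1 by lia.
  by apply: ed; lia.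
Qed.

Lemma upath_eq f f' p m : upath f p m -> (forall i, i < m -> f' (p i) = f (p i)) ->
  upath f' p m.
Proof.
by move=> [un inj ed] eqf; split=> // i im; rewrite eqf //; apply: un.
Qed.

Definition sees_all f v (S : nat -> bool) := forall c, c < 4 -> S c -> sees e f v c.

Lemma sees_all_legal f f' v S : legal_move e f f' -> sees_all f v S ->
  sees_all f' v S.
Proof. by move=> lf sS c c4 /(sS c c4); apply: sees_legal. Qed.

(* S c (+) odd m says that c belongs to S if m is even, to its complement if m is
   odd. *)
Definition alice_path m := forall f p S, Defs.proper e f -> upath f p m ->
  balanced S -> #|colored f| + 6 * m + 6 < K -> sees_all f (p 0) S ->
  sees_all f (p m.-1) (fun c => S c (+) odd m) -> bob_wins e true f.

Definition bob_path m := forall f p S c, Defs.proper e f -> upath f p m ->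
  balanced S -> #|colored f| + 6 * m + 7 < K -> sees_all f (p 0) S ->
  c < 4 -> S c (+) odd m -> sees e f (p m.-1) c -> bob_wins e false f.

Lemma bob_path_of_alice m : 0 < m -> alice_path m -> bob_path m.
Proof.
move=> m0 aw f p S c pf up bS ltK s0 c4 Sc sc.
have [_ /(_ c c4)[c' c'4 [_ uq]]] := balanced_addb (odd m) bS.
have [un _ _] := up; have m1m : m.-1 < m by lia.
have [fv lv] := un _ m1m; have ltX := card_pset p m.
apply: (@mark _ _ c' (pset p m) pf fv lv (mem_pset _ m1m)); first by lia.
move=> f' lf sc' eqf.
apply: (aw f' p S (legal_proper lf)) => //.
- by apply: (upath_eq up) => i im; apply: eqf; apply: mem_pset.
- by rewrite (card_colored_legal lf); lia.
- exact: sees_all_legal lf s0.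
move=> x x4 Sx; case: (uq x x4) => [|->|->//]; first by rewrite Sx Sc.
exact: sees_legal lf sc.
Qed.

Lemma alice_pathP m : 0 < m -> alice_path m.
Proof.
have [M] := ubnP m; elim: M m => // M IHM m ltM m0 f p S pf up bS ltK s0 s1.
have BP t : 0 < t -> t < m -> bob_path t.
  by move=> t0 tm; apply: bob_path_of_alice => //; apply: IHM => //; lia.
have [un inj ed] := up.
have [[fp0 lp0] [fp1 lp1]] := (un 0 m0, un m.-1 ltac:(lia)).
have ltX := card_pset p m.
apply: (alice_turn k4 fp0) => f' v a lf fv f'v a4 eqf nsa sa.
have pf' := legal_proper lf; have cf' := card_colored_legal lf.
case: (boolP (v \in pset p m)) => [/imsetP[[t tm] /= _ vE]|vp].
  have eqt i : i < m -> i != t -> f' (p i) = f (p i).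
    move=> im /eqP it; apply: eqf => piv; apply: it.
    by apply: inj => //; rewrite piv.
  (* Since t + (m - 1 - t) = m - 1, the parity condition holds for exactly one of
     the two pieces of the path. *)
  case: (boolP (S a (+) odd t)) => Sat.
    have t0 : 0 < t.
      case: t vE Sat {tm eqt} => // vE; rewrite addbF => Sa.
      by case: nsa; rewrite vE; apply: s0.
    apply: (BP t t0 tm f' p S a) => //.
    - apply: (upath_eq (f := f)).
        by apply: (upath_sub (i := 0) up); lia.
      by move=> i it; apply: eqt; lia.
    - by lia.
    - exact: sees_all_legal lf s0.
    - by apply: sa; rewrite vE -{2}(prednK t0); apply: ed; lia.
  have Sa' : S a (+) odd m (+) odd (m.-1 - t).
    have mE : m = (t + (m.-1 - t)).+1 by lia.
    move: Sat; move: (m.-1 - t) mE => r ->; rewrite /= oddD.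
    by case: (S a); case: (odd t); case: (odd r).
  have t1 : 0 < m.-1 - t.
    case: (posnP (m.-1 - t)) => // E; rewrite E addbF in Sa'.
    have tE : t = m.-1 by lia.
    by case: nsa; rewrite vE tE; apply: s1.
  apply: (BP _ t1 _ f' (fun j => p (m.-1 - j)) (fun c => S c (+) odd m) a) => //.
  - by lia.
  - apply: (upath_eq (f := f)).
      by apply: (upath_sub (i := 0) (upath_rev up)); lia.
    by move=> i it; apply: eqt; lia.
  - exact: balanced_addb.
  - by lia.
  - by rewrite subn0; apply: sees_all_legal lf s1.
  apply: sa; rewrite vE; have -> : m.-1 - (m.-1 - t).-1 = t.+1 by lia.
  by rewrite e_sym; apply: ed; lia.
have up' : upath f' p m.
  apply: (upath_eq up) => i im; apply: eqf => piv; move: vp.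
  by rewrite -piv mem_pset.
have [un' _ _] := up'; have [f'p0 _] := un' 0 m0.
have [ex pr] := bS.
have [c c4 Sc] := ex false; have [c' c'4 [Sc' uq]] := pr c c4.
apply: (@mark _ _ c (pset p m) pf' f'p0 lp0 (mem_pset _ m0)); first by lia.
move=> f2 lf2 sc eqf2; have cf2 := card_colored_legal lf2.
have up2 : upath f2 p m.
  by apply: (upath_eq up') => i im; apply: eqf2; apply: mem_pset.
have [un2 _ _] := up2; have [f2p0 _] := un2 0 m0.
apply: (alice_turn k4 f2p0) => f3 w b lf3 fw f3w b4 eqf3 nsb sb.
have pf3 := legal_proper lf3; have cf3 := card_colored_legal lf3.
have s03 : sees_all f3 (p 0) S.
  by apply: sees_all_legal lf3 (sees_all_legal lf2 (sees_all_legal lf s0)).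
have s13 : sees_all f3 (p m.-1) (fun c => S c (+) odd m).
  by apply: sees_all_legal lf3 (sees_all_legal lf2 (sees_all_legal lf s1)).
have [wE|wp0] := eqVneq w (p 0).
  have Sb : S b = false.
    apply/negP => Sb; case: nsb; rewrite wE.
    exact: sees_all_legal lf2 (sees_all_legal lf s0) _ b4 Sb.
  have m1 : 0 < m.-1.
    case: (posnP m.-1) => // E; have m1 : m = 1 by lia.
    case: nsb; rewrite wE -[p 0]/(p (1.-1)) -m1.
    apply: sees_all_legal lf2 (sees_all_legal lf s1) _ b4 _.
    by rewrite Sb m1.
  apply: (BP m.-1 m1 _ f3 (fun j => p (m.-1 - j)) (fun c => S c (+) odd m) b) => //.
  - by lia.
  - apply: (upath_eq (f := f2)).
      by apply: (upath_sub (i := 0) (upath_rev up2)); lia.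
    move=> i im; apply: eqf3 => /=; rewrite wE => /inj.
    by lia.
  - exact: balanced_addb.
  - by lia.
  - by rewrite subn0.
  - by rewrite Sb -{1}(prednK m0) /=; case: (odd _).
  apply: sb; rewrite wE; have -> : m.-1 - m.-1.-1 = 1 by lia.
  by rewrite e_sym; apply: ed; lia.
have f3p0 : f3 (p 0) = None by rewrite eqf3 // => E; rewrite E eqxx in wp0.
apply: (@mark _ _ c' (pset p m) pf3 f3p0 lp0 (mem_pset _ m0)); first by lia.
move=> f4 lf4 sc' eqf4.
have f4p0 : f4 (p 0) = None by rewrite eqf4 // mem_pset.
apply: (bob_wins_sees_all k4 _ f4p0) => x x4.
case Sx : (S x); first exact: sees_all_legal lf4 s03 _ x4 Sx.
case: (uq x x4) => [|->|->//]; first by rewrite Sx Sc.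
exact: sees_legal lf4 (sees_legal lf3 sc).
Qed.

Lemma bob_pathP m : 0 < m -> bob_path m.
Proof. by move=> m0; apply: bob_path_of_alice => //; apply: alice_pathP. Qed.

Definition ulollipop f l' q : Prop :=
  upath f q (l' + n) /\ e (q l') (q (l' + n).-1).

Lemma ulollipop_eq f f' l' q : ulollipop f l' q ->
  (forall i, i < l' + n -> f' (q i) = f (q i)) -> ulollipop f' l' q.
Proof. by move=> [up cl] eqf; split=> //; apply: upath_eq up eqf. Qed.

Lemma upath_around f l' q : ulollipop f l' q ->
  upath f (fun i => if i <= l' then q i else q (l' + l' + n - i)) (l' + n).-1.
Proof.
move=> [[un inj ed] cl]; split=> [i im|i j im jm|i im].
- by case: ifP => il; apply: un; lia.
- by case: ifP => il; case: ifP => jl /inj; lia.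
- case: (ltngtP i l') => il.
  + by apply: ed; lia.
  + rewrite e_sym; have -> : l' + l' + n - i = (l' + l' + n - i.+1).+1 by lia.
    by apply: ed; lia.
  + by rewrite il; have -> : l' + l' + n - l'.+1 = (l' + n).-1 by lia.
Qed.

(* In a lollipop q, the vertices q 0, ..., q l'.-1 form the handle and q l', ...,
   q (l' + n).-1 the cycle. *)
Definition alice_lollipop l' := forall f q S x, Defs.proper e f ->
  ulollipop f l' q -> balanced S -> #|colored f| + 6 * (l' + n) + 2 * l' + 12 < K ->
  sees_all f (q 0) S -> x < 4 -> S x (+) odd l' -> sees e f (q l'.+1) x ->
  bob_wins e true f.

Definition bob_lollipop l' := forall f q a x, Defs.proper e f ->
  ulollipop f l' q -> #|colored f| + 6 * (l' + n) + 2 * l' + 13 < K ->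
  a < 4 -> x < 4 -> (odd l' -> a <> x) ->
  sees e f (q 0) a -> sees e f (q l'.+1) x -> bob_wins e false f.

Lemma sees_all_pair2 f v a b : sees e f v a -> sees e f v b ->
  sees_all f v (pair2 a b).
Proof. by move=> sa sb c _ /pair2P[]->. Qed.

Lemma bob_lollipop_of_alice l' : alice_lollipop l' -> bob_lollipop l'.
Proof.
move=> aw f q a x pf ul ltK a4 x4 ax sa sx.
have [b b4 [ab Sx]] : exists2 b, b < 4 & a <> b /\ pair2 a b x (+) odd l'.
  have [xa|xa] := eqVneq a x.
    have nodd : odd l' = false by apply/negP => /ax.
    exists (if a == 0 then 1 else 0); first by case: ifP.
    by rewrite nodd /pair2 -xa eqxx; split=> //; case: (a).
  case: (boolP (odd l')) => ol; last first.
    exists x => //; split; first exact/eqP.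
    by rewrite /pair2 eqxx orbT.
  have [/(_ false)[b b4 Sb] _] := balanced_pair2 a4 x4 (ax ol).
  have [ba bx] : b <> a /\ b <> x.
    by split=> E; rewrite E /pair2 eqxx ?orbT in Sb.
  exists b => //; split; first by auto.
  by rewrite addbT /pair2 negb_or eq_sym xa; apply/eqP => /esym.
have [[un inj ed] cl] := ul.
have [fq lq] := un 0 ltac:(lia); have ltX := card_pset q (l' + n).
apply: (@mark _ _ b (pset q (l' + n)) pf fq lq); [apply: mem_pset; lia|lia|].
move=> f' lf sb eqf; apply: (aw f' q (pair2 a b) x (legal_proper lf)) => //.
- by apply: (ulollipop_eq ul) => i im; apply: eqf; apply: mem_pset.
- exact: balanced_pair2.
- by rewrite (card_colored_legal lf); lia.
- by apply: sees_all_pair2 => //; apply: sees_legal lf sa.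
- exact: sees_legal lf sx.
Qed.

Lemma alice_lollipopP l' : alice_lollipop l'.
Proof.
have [M] := ubnP l'; elim: M l' => // M IHM l' ltM f q S x pf ul bS ltK s0 x4 Sx sx.
have BL t : t < l' -> bob_lollipop t.
  by move=> tl; apply: bob_lollipop_of_alice; apply: IHM; lia.
have [up cl] := ul; have [un inj ed] := up.
have [fq lq] := un 0 ltac:(lia).
apply: (alice_turn k4 fq) => f' v a lf fv f'v a4 eqf nsa sa.
have pf' := legal_proper lf; have cf' := card_colored_legal lf.
have s0' := sees_all_legal lf s0; have sx' := sees_legal lf sx.
have eqt t : t < l' + n -> v = q t -> forall i, i < l' + n -> i <> t ->
    f' (q i) = f (q i).
  move=> tm vE i im it; apply: eqf; rewrite vE => /inj E; exact/it/E.
case: (boolP (v \in pset q (l'.+2))) => [/imsetP[[t tm] /= _ vE]|vq]; last first.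
  apply: (bob_pathP _ (m := l'.+2) (f := f') (p := q) (S := S) (c := x)) => //.
  - apply: (upath_eq (f := f)).
      by apply: (upath_sub (i := 0) up); lia.
    by move=> i im; apply: eqf => E; rewrite -E mem_pset in vq.
  - by lia.
  - by rewrite /= negbK.
have left_path : 0 < t -> t <= l'.+1 -> S a (+) odd t -> bob_wins e false f'.
  move=> t0 tl Sat.
  apply: (bob_pathP _ (m := t) (f := f') (p := q) (S := S) (c := a)) => //.
  - apply: (upath_eq (f := f)).
      by apply: (upath_sub (i := 0) up); lia.
    by move=> i it; apply: (eqt t) => //; lia.
  - by lia.
  - by apply: sa; rewrite vE -{2}(prednK t0); apply: ed; lia.
have Sa0 : t = 0 -> S a = false.
  by move=> t0; apply/negP => Sa; case: nsa; rewrite vE t0; apply: s0.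
case: (boolP (S a (+) odd t)) => Sat.
  case: (posnP t) => t0; last by apply: left_path => //; lia.
  by rewrite t0 (Sa0 t0) in Sat.
have Sat' : S a = odd t by move: Sat; case: (S a); case: (odd t).
case: (ltngtP t l') => tl.
- have tn : l' = t.+1 + (l' - t.+1) by lia.
  apply: (BL (l' - t.+1) _ f' (fun j => q (t.+1 + j)) a x) => //; first by lia.
  + split; last first.
      by rewrite -tn; have -> : t.+1 + (l' - t.+1 + n).-1 = (l' + n).-1 by lia.
    apply: (upath_eq (f := f)); first by apply: (upath_sub up); lia.
    by move=> i im; apply: (eqt t) => //; lia.
  + by lia.
  + move=> ol ax; move: Sx; rewrite -ax Sat' {1}tn oddD ol /=.
    by case: (odd t).
  + by apply: sa; rewrite vE addn0 e_sym; apply: ed; lia.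
  + by rewrite addnS -tn.
- have tE : t = l'.+1 by lia.
  have up2 := upath_eq (f' := f') (upath_around ul).
  apply: (bob_pathP _ pf' (up2 _) bS _ _ a4) => //=.
  + by lia.
  + by move=> i im; case: ifP => il; apply: (eqt t) => //; lia.
  + by lia.
  + have -> : (l' + n).-1 = l' + n.-1 by lia.
    rewrite oddD n1_even addbF.
    by rewrite Sat' tE /=; case: (odd l').
  + have -> : (l' + n).-1.-1 <= l' = false by lia.
    have -> : l' + l' + n - (l' + n).-1.-1 = t.+1 by lia.
    by apply: sa; rewrite vE e_sym; apply: ed; lia.
- have ax : nat_of_ord a <> x by move=> ax; move: Sx; rewrite -ax Sat' tl; case: (odd l').
  apply: (bob_pathP _ (m := n.-1) (f := f') (p := fun j => q (l'.+1 + j))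
    (S := pair2 a x) (c := a)) => //.
  + by lia.
  + apply: (upath_eq (f := f)); first by apply: (upath_sub up); lia.
    by move=> i im; apply: (eqt t) => //; lia.
  + exact: balanced_pair2.
  + by lia.
  + apply: sees_all_pair2; rewrite addn0 //.
    by apply: sa; rewrite vE tl e_sym; apply: ed; lia.
  + by rewrite /pair2 eqxx n1_even.
  + apply: sa; rewrite vE tl e_sym.
    by have -> : l'.+1 + n.-1.-1 = (l' + n).-1 by lia.
Qed.

Lemma bob_lollipop2 l' f q a b : Defs.proper e f -> ulollipop f l' q ->
  #|colored f| + 6 * (l' + n) + 2 * l' + 13 < K -> a < 4 -> b < 4 -> a <> b ->
  sees e f (q 0) a -> sees e f (q 0) b -> bob_wins e false f.
Proof.
move=> pf ul ltK a4 b4 ab sa sb; have bS := balanced_pair2 a4 b4 ab.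
have [/(_ (~~ odd l'))[x x4 Sx] _] := bS.
have [[un inj ed] cl] := ul.
have [fq lq] := un l'.+1 ltac:(lia); have ltX := card_pset q (l' + n).
apply: (@mark _ _ x (pset q (l' + n)) pf fq lq); [apply: mem_pset; lia|lia|].
move=> f' lf sx eqf.
apply: (@alice_lollipopP l' f' q (pair2 a b) x (legal_proper lf)) => //.
- by apply: (ulollipop_eq ul) => i im; apply: eqf; apply: mem_pset.
- by rewrite (card_colored_legal lf); lia.
- by apply: sees_all_pair2; apply: sees_legal lf _.
- by rewrite Sx; case: (odd l').
Qed.

Lemma bob_edge f v w a b : Defs.proper e f -> #|colored f| + 20 < K ->
  f v = None -> f w = None -> lev v <= 2 -> lev w <= 2 -> e v w ->
  a < 4 -> b < 4 -> a <> b -> sees e f v a -> sees e f v b -> sees e f w a ->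
  bob_wins e false f.
Proof.
move=> pf ltK fv fw lv lw vw a4 b4 ab sa sb wa.
apply: (@bob_pathP 2 _ f (fun i => if i == 0 then v else w) (pair2 a b) a) => //=.
- split=> [[|[|]]|[|[|i]] [|[|j]]|[|[|]]] //= _ _ E; by rewrite E e_irr in vw.
- exact: balanced_pair2.
- by lia.
- exact: sees_all_pair2.
- by rewrite /pair2 eqxx.
Qed.

Definition sees_free f v a := [/\ f v = None, lev v <= 2 & sees e f v a].

Lemma sees_free_legal f f' v a : legal_move e f f' -> f' v = f v ->
  sees_free f v a -> sees_free f' v a.
Proof. by move=> lf eqv [fv lv sa]; split; rewrite ?eqv //; apply: sees_legal lf sa. Qed.

Lemma bob_edge_after f f' v w w' (g : 'I_k) a : #|colored f| + 21 < K ->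
  legal_move e f f' -> f' v = Some g -> (forall x, x <> v -> f' x = f x) ->
  ~ sees e f v g -> a < 4 -> sees e f v a -> sees_free f w a ->
  sees_free f w' a -> e v w -> e w w' -> w' <> v -> bob_wins e false f'.
Proof.
move=> ltK lf f'v eqf nsg a4 va sw sw' vw ww' w'v.
have wv : w <> v by move=> wv; rewrite wv e_irr in vw.
have [f'w lw wa] := sees_free_legal lf (eqf _ wv) sw.
have [f'w' lw' wa'] := sees_free_legal lf (eqf _ w'v) sw'.
have gk := ltn_ord g.
apply: (@bob_edge f' w w' a g) => //.
- exact: legal_proper lf.
- by rewrite (card_colored_legal lf); lia.
- exact: leq_trans gk k4.
- by move=> ag; apply: nsg; rewrite -ag.
- by rewrite e_sym in vw; apply: sees_Some vw f'v.
Qed.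

Lemma bob_quad f (x c z y : T) a : Defs.proper e f -> #|colored f| + 30 < K ->
  uniq [:: x; c; z; y] -> e x c -> e c z -> e z y -> a < 4 ->
  sees_free f x a -> sees_free f c a -> sees_free f z a -> sees_free f y a ->
  bob_wins e false f.
Proof.
move=> pf ltK un xc cz zy a4 sx sc sz sy.
have [fc lc _] := sc.
pose b := if a == 0 then 1 else 0.
have b4 : b < 4 by rewrite /b; case: ifP.
have ab : a <> b by rewrite /b; case: (a).
clearbody b.
pose X := [set v in [:: x; c; z; y]].
have lX : #|X| <= 4 by rewrite cardsE; apply: (card_size [:: x; c; z; y]).
apply: (@mark f c b X) => //; [by rewrite !inE eqxx !orbT|by lia|].
move=> f1 lf1 sb eqf1.
have step1 v : v \in X -> sees_free f v a -> sees_free f1 v a.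
  by move=> vX; apply: sees_free_legal lf1 (eqf1 _ vX).
have {}sx : sees_free f1 x a by apply: step1 => //; rewrite !inE eqxx.
have {}sc : sees_free f1 c a by apply: step1 => //; rewrite !inE eqxx !orbT.
have {}sz : sees_free f1 z a by apply: step1 => //; rewrite !inE eqxx !orbT.
have {}sy : sees_free f1 y a by apply: step1 => //; rewrite !inE eqxx !orbT.
have [f1c _ _] := sc; have cf1 := card_colored_legal lf1.
apply: (alice_turn k4 f1c) => f2 v g lf2 f1v f2v g4 eqf2 nsg sg.
have pf2 := legal_proper lf2; have cf2 := card_colored_legal lf2.
have [lt2 lt1] : #|colored f2| + 20 < K /\ #|colored f1| + 21 < K by lia.
move: un; rewrite /= !inE !negb_or -!andbA => /and5P[xc' xz xy cz' /and3P[cy zy' _]].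
have [vc|vc] := eqVneq c v.
  apply: (bob_edge_after _ lf2 f2v eqf2 nsg a4 _ sz sy); rewrite -?vc //.
  - by case: sc.
  - by apply/eqP; rewrite eq_sym.
have [f2c _ ca] := sees_free_legal lf2 (eqf2 _ (elimN eqP vc)) sc.
have cb := sees_legal lf2 sb.
have [vx|/eqP vx] := eqVneq x v.
  have zv : z <> v by rewrite -vx; apply/eqP; rewrite eq_sym.
  have [f2z lz za] := sees_free_legal lf2 (eqf2 _ zv) sz.
  exact: (@bob_edge f2 c z a b).
have [f2x lx xa] := sees_free_legal lf2 (eqf2 _ vx) sx.
by apply: (@bob_edge f2 c x a b) => //; rewrite e_sym.
Qed.

Lemma alice_quad f (x c z y : T) a : Defs.proper e f -> #|colored f| + 31 < K ->
  uniq [:: x; c; z; y] -> e x c -> e c z -> e z y -> a < 4 ->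
  sees_free f x a -> sees_free f c a -> sees_free f z a -> sees_free f y a ->
  bob_wins e true f.
Proof.
move=> pf ltK un xc cz zy a4 sx sc sz sy; have [fc _ ca] := sc.
have [[_ _ xa] [_ _ za] [_ _ ya]] := And3 sx sz sy.
apply: (alice_turn k4 fc) => f2 v g lf2 fv f2v g4 eqf2 nsg sg.
have lt2 : #|colored f2| + 30 < K by rewrite (card_colored_legal lf2); lia.
have lt1 : #|colored f| + 21 < K by lia.
have after w w' w'' : v = w -> sees e f w a -> sees_free f w' a ->
    sees_free f w'' a -> e w w' -> e w' w'' -> w'' != w -> bob_wins e false f2.
  move=> vw wa sw' sw'' ww' w'w'' /eqP w''w; rewrite -vw in wa ww' w''w.
  by apply: (bob_edge_after _ lf2 f2v eqf2 nsg a4 wa sw' sw'').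
have un' := un.
move: un; rewrite /= !inE !negb_or -!andbA => /and5P[xc' xz xy cz' /and3P[cy zy' _]].
have [vx|vx] := eqVneq v x; first by apply: (after x c z); rewrite // eq_sym.
have [vc|vc] := eqVneq v c; first by apply: (after c z y); rewrite // eq_sym.
have [vz|vz] := eqVneq v z; first by apply: (after z c x); rewrite // e_sym.
have [vy|vy] := eqVneq v y; first by apply: (after y z c); rewrite // e_sym.
have step w : v != w -> sees_free f w a -> sees_free f2 w a.
  by move=> vw; apply: sees_free_legal lf2 (eqf2 _ _); apply/eqP; rewrite eq_sym.
by apply: (@bob_quad f2 x c z y a) => //; [exact: legal_proper lf2|exact: step..].
Qed.

Lemma mark_pendant f v a (X : {set T}) : Defs.proper e f -> f v = None ->
  lev v <= 1 -> #|colored f| + #|X| + 1 < K ->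
  (forall f' y, legal_move e f f' -> e v y -> y \notin X -> sees_free f' y a ->
     (forall x, x \in X -> f' x = f x) -> bob_wins e true f') ->
  bob_wins e false f.
Proof.
move=> pf fv lv ltK H.
have ltD : #|colored f :|: X| < K by have := (leq_card_setU (colored f) X).1; lia.
have [q [[lq _ _ _] qD vq0 _]] := branch (leq_trans lv (leqnSn _)) ltD.
have q0 : 0 < l + n by lia.
have := qD 0 q0; rewrite !inE negb_or negbK => /andP[/eqP fy yX].
have ly : lev (q 0) <= 2 by rewrite lq.
apply: (@mark f (q 0) a (q 0 |: X)) => //.
- by rewrite !inE eqxx.
- by rewrite cardsU1 yX; lia.
move=> f' lf sa eqf; apply: (H f' (q 0)) => //.
  by split=> //; rewrite eqf // !inE eqxx.
by move=> x xX; apply: eqf; rewrite !inE xX orbT.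
Qed.

Lemma bob_triple f (x c z : T) a : Defs.proper e f -> #|colored f| + 40 < K ->
  uniq [:: x; c; z] -> e x c -> e c z -> lev z <= 1 -> a < 4 ->
  sees_free f x a -> sees_free f c a -> sees_free f z a ->
  bob_wins e false f.
Proof.
move=> pf ltK un xc cz lz a4 sx sc sz.
pose X := [set v in [:: x; c; z]].
have lX : #|X| <= 3 by rewrite cardsE; apply: (card_size [:: x; c; z]).
have [fz _ _] := sz.
apply: (@mark_pendant f z a X) => //; first by lia.
move=> f' y lf zy yX sy eqf.
have step v : v \in X -> sees_free f v a -> sees_free f' v a.
  by move=> vX; apply: sees_free_legal lf (eqf _ vX).
apply: (@alice_quad f' x c z y a) => //.
- exact: legal_proper lf.
- by rewrite (card_colored_legal lf); lia.
- rewrite -[[:: _; _; _; _]]/(rcons [:: x; c; z] y) rcons_uniq un andbT.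
  by move: yX; rewrite inE.
- by apply: step; rewrite // !inE eqxx.
- by apply: step; rewrite // !inE eqxx !orbT.
- by apply: step; rewrite // !inE eqxx !orbT.
Qed.

Lemma alice_triple f (x c z : T) a : Defs.proper e f -> #|colored f| + 41 < K ->
  uniq [:: x; c; z] -> e x c -> e c z -> lev z <= 1 -> a < 4 ->
  sees_free f x a -> sees_free f c a -> sees_free f z a ->
  (forall f' (g : 'I_k), legal_move e f f' -> f' c = Some g ->
     (forall x, x <> c -> f' x = f x) -> g < 4 -> a <> g ->
     (forall w, e w c -> sees e f' w g) -> bob_wins e false f') ->
  bob_wins e true f.
Proof.
move=> pf ltK un xc cz lz a4 sx sc sz H; have [fc _ ca] := sc.
have [[_ _ xa] [_ _ za]] := conj sx sz.
apply: (alice_turn k4 fc) => f2 v g lf2 fv f2v g4 eqf2 nsg sg.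
have [lt2 lt1] : #|colored f2| + 40 < K /\ #|colored f| + 21 < K.
  by rewrite (card_colored_legal lf2); lia.
have un' := un; move: un; rewrite /= !inE !negb_or -!andbA => /and4P[xc' xz cz' _].
have [vc|vc] := eqVneq v c.
  rewrite vc in f2v eqf2 sg nsg; apply: (H f2 g) => //.
  by move=> ag; apply: nsg; rewrite -ag.
have [vx|vx] := eqVneq v x.
  rewrite vx in f2v eqf2 nsg.
  apply: (bob_edge_after _ lf2 f2v eqf2 nsg a4 xa sc sz) => //.
  by apply/eqP; rewrite eq_sym.
have [vz|vz] := eqVneq v z.
  rewrite vz in f2v eqf2 nsg.
  apply: (bob_edge_after _ lf2 f2v eqf2 nsg a4 za sc sx); rewrite 1?e_sym //.
  exact/eqP.
have step w : v != w -> sees_free f w a -> sees_free f2 w a.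
  by move=> vw; apply: sees_free_legal lf2 (eqf2 _ _); apply/eqP; rewrite eq_sym.
by apply: (@bob_triple f2 x c z a) => //; [exact: legal_proper lf2|exact: step..].
Qed.

(* The branch q at p 0 gives Bob a second threat: if Alice colors p 0, he wins in
   the lollipop, if she colors q 0, he wins on the path. *)
Lemma bob_even_path f p m q a : Defs.proper e f -> upath f p m -> 0 < m ->
  ~~ odd m -> lev (p 0) <= 1 -> ulollipop f l q -> lev (q 0) <= 1 ->
  e (p 0) (q 0) -> (forall i j, i < m -> j < l + n -> p i <> q j) -> a < 4 ->
  sees e f (p 0) a -> sees e f (p m.-1) a ->
  #|colored f| + 6 * (l + n) + 2 * l + 6 * m + 60 < K -> bob_wins e false f.
Proof.
move=> pf up m0 m_even lp ul lq pq dis a4 p0a p1a ltK.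
pose X := pset p m :|: pset q (l + n).
have lX : #|X| <= m + (l + n).
  by rewrite /X; have := (leq_card_setU (pset p m) (pset q (l + n))).1; have := card_pset p m;
     have := card_pset q (l + n); lia.
have [[uq _ _] _] := ul; have [un _ _] := up.
have [fq lq'] := uq 0 ltac:(lia).
have pX i : i < m -> p i \in X by move=> im; rewrite inE mem_pset.
have qX i : i < l + n -> q i \in X by move=> im; rewrite inE (mem_pset _ im) orbT.
apply: (@mark f (q 0) a X) => //; [by apply: qX; lia|by lia|].
move=> f1 lf1 q0a eqf1; have cf1 := card_colored_legal lf1.
have {}up : upath f1 p m by apply: (upath_eq up) => i im; apply/eqf1/pX.
have {}ul : ulollipop f1 l q by apply: (ulollipop_eq ul) => i im; apply/eqf1/qX.
have {}p0a := sees_legal lf1 p0a; have {}p1a := sees_legal lf1 p1a.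
have [[uq1 _ _] _] := ul; have [un1 injp _] := up.
have [f1q lq2] := uq1 0 ltac:(lia); have [f1p lp2] := un1 0 m0.
have {cf1}[lt1 lt1' lt1''] : [/\ #|colored f1| + 6 * (l + n) + 2 * l + 6 * m + 50 < K,
  #|colored f1| + #|X| + 50 < K & 0 < l + n] by split; lia.
have win_q f' g : Defs.proper e f' -> ulollipop f' l q -> g < 4 -> a <> g ->
    #|colored f'| <= #|colored f1| + 3 -> sees e f' (q 0) a ->
    sees e f' (q 0) g -> bob_wins e false f'.
  by move=> pf' ul' g4 ag cf' qa qg; apply: (@bob_lollipop2 l f' q a g) => //; lia.
have win_p f' g : Defs.proper e f' -> upath f' p m -> g < 4 -> a <> g ->
    #|colored f'| <= #|colored f1| + 3 -> sees e f' (p 0) a ->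
    sees e f' (p 0) g -> sees e f' (p m.-1) a -> bob_wins e false f'.
  move=> pf' up' g4 ag cf' pa pg pma.
  apply: (@bob_pathP m m0 f' p (pair2 a g) a) => //; first exact: balanced_pair2.
  - by lia.
  - exact: sees_all_pair2.
  - by rewrite /pair2 eqxx (negbTE m_even).
apply: (alice_turn k4 f1q) => f2 v g lf2 f1v f2v g4 eqf2 nsg sg.
have pf2 := legal_proper lf2; have cf2 := card_colored_legal lf2.
have {q0a}[q0a q0a2] := (q0a, sees_legal lf2 q0a).
have {p0a}[p0a p0a2] := (p0a, sees_legal lf2 p0a).
have p1a2 := sees_legal lf2 p1a.
have lt2 : #|colored f2| <= #|colored f1| + 3 by lia.
have lt2X : #|colored f2| + #|X| + 1 < K by lia.
have lt2' : #|colored f2| + 45 < K by lia.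
have [vp|vp] := eqVneq v (p 0).
  rewrite vp in f2v eqf2 sg nsg; apply: (win_q f2 g) => //.
  - apply: (ulollipop_eq ul) => i im; apply: eqf2 => E.
    exact: (dis 0 i m0 im (esym E)).
  - by move=> ag; apply: nsg; rewrite -ag.
  - by apply: sg; rewrite e_sym.
have [vq|vq] := eqVneq v (q 0).
  rewrite vq in f2v eqf2 sg nsg; apply: (win_p f2 g) => //.
  - by apply: (upath_eq up) => i im; apply: eqf2; apply: dis.
  - by move=> ag; apply: nsg; rewrite -ag.
  - exact: sg.
have f2p0 : f2 (p 0) = None by rewrite eqf2 // => E; rewrite E eqxx in vp.
have f2q0 : f2 (q 0) = None by rewrite eqf2 // => E; rewrite E eqxx in vq.
case: (boolP (v \in pset p m)) => [/imsetP[[t tm] /= _ vE]|vpm].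
  have ul2 : ulollipop f2 l q.
    apply: (ulollipop_eq ul) => i im; apply: eqf2 => E.
    by apply: (dis t i tm im); rewrite -vE.
  apply: (@mark_pendant f2 (p 0) a X) => // f3 y lf3 py yX sy eqf3.
  have pf3 := legal_proper lf3; have cf3 := card_colored_legal lf3.
  have lt3 : #|colored f3| + 41 < K by lia.
  have lt3' : #|colored f3|.+1 <= #|colored f1| + 3 by lia.
  have ul3 : ulollipop f3 l q by apply: (ulollipop_eq ul2) => i im; apply/eqf3/qX.
  apply: (@alice_triple f3 y (p 0) (q 0) a) => //.
  - rewrite /= !inE !andbT negb_or -andbA; apply/and3P; split; apply: contraNneq yX.
    + by move->; apply: pX.
    + by move->; apply: qX.
    + by move/(dis _ _ m0 lt1'').
  - by rewrite e_sym.
  - by split; rewrite ?eqf3 ?pX //; apply: sees_legal lf3 p0a2.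
  - by split; rewrite ?eqf3 ?qX //; apply: sees_legal lf3 q0a2.
  move=> f4 h lf4 f4p eqf4 h4 ah sh; apply: (win_q f4 h) => //.
  - exact: legal_proper lf4.
  - apply: (ulollipop_eq ul3) => i im; apply: eqf4 => E.
    exact: (dis 0 i m0 im (esym E)).
  - by rewrite (card_colored_legal lf4).
  - exact: sees_legal lf4 (sees_legal lf3 q0a2).
  - by apply: sh; rewrite e_sym.
have up2 : upath f2 p m.
  by apply: (upath_eq up) => i im; apply: eqf2 => E; rewrite -E mem_pset in vpm.
apply: (@mark_pendant f2 (q 0) a X) => // f3 y lf3 py yX sy eqf3.
have pf3 := legal_proper lf3; have cf3 := card_colored_legal lf3.
have lt3 : #|colored f3| + 41 < K by lia.
have lt3' : #|colored f3|.+1 <= #|colored f1| + 3 by lia.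
have up3 : upath f3 p m by apply: (upath_eq up2) => i im; apply/eqf3/pX.
apply: (@alice_triple f3 y (q 0) (p 0) a) => //.
- rewrite /= !inE !andbT negb_or -andbA; apply/and3P; split; apply: contraNneq yX.
  + by move->; apply: qX.
  + by move->; apply: pX.
  + by move/esym/(dis _ _ m0 lt1'').
- by rewrite e_sym.
- by rewrite e_sym.
- by split; rewrite ?eqf3 ?qX //; apply: sees_legal lf3 q0a2.
- by split; rewrite ?eqf3 ?pX //; apply: sees_legal lf3 p0a2.
move=> f4 h lf4 f4p eqf4 h4 ah sh; apply: (win_p f4 h) => //.
- exact: legal_proper lf4.
- by apply: (upath_eq up3) => i im; apply: eqf4; apply: dis.
- by rewrite (card_colored_legal lf4).
- exact: sees_legal lf4 (sees_legal lf3 p0a2).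
- exact: sh.
- exact: sees_legal lf4 (sees_legal lf3 p1a2).
Qed.

Variable r : nat -> T.
Hypotheses (r_lev : forall i, i < n -> lev (r i) = 0)
  (r_inj : forall i j, i < n -> j < n -> r i = r j -> i = j)
  (r_path : forall i, i.+1 < n -> e (r i) (r i.+1))
  (r_close : e (r 0) (r n.-1)).

Let modn_ltn i : i %% n < n.
Proof. by rewrite ltn_mod; lia. Qed.

Lemma r_edge i : e (r (i %% n)) (r (i.+1 %% n)).
Proof.
have := modn_ltn i; rewrite leq_eqVlt => /orP[/eqP E|lt].
  have -> : i.+1 %% n = 0 by rewrite -addn1 -modnDml addn1 E modnn.
  by rewrite e_sym -[i %% n]/(i %% n).+1.-1 E.
have -> : i.+1 %% n = (i %% n).+1.
  by rewrite -addn1 -modnDml addn1 modn_small.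
exact: r_path.
Qed.

Hypothesis ltK : 6 * (l + n) + 2 * l + 6 * n + 80 < K.

(* The color of r i is seen at both ends of the path formed by the n - 1 other
   vertices of the cycle, and n - 1 is even. *)
Lemma bob_hit f i (a : 'I_k) : Defs.proper e f -> i < n -> f (r i) = Some a ->
  (forall j, j < n -> j != i -> f (r j) = None) -> #|colored f| <= 5 ->
  bob_wins e false f.
Proof.
move=> pf im fi fj cf.
pose p j := r ((i.+1 + j) %% n).
have p0 : e (p 0) (r i).
  by rewrite e_sym /p addn0 -{1}(modn_small im); apply: r_edge.
have p1 : e (p n.-1.-1) (r i).
  have E : (i.+1 + n.-1.-1).+1 %% n = i.
    have -> : (i.+1 + n.-1.-1).+1 = i + n by lia.
    by rewrite modnDr modn_small.
  by have := r_edge (i.+1 + n.-1.-1); rewrite E.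
have inj j j' : j < n -> j' < n -> p j = p j' -> j = j'.
  move=> jn j'n /(r_inj (modn_ltn _) (modn_ltn _))/eqP; rewrite eqn_modDl.
  by rewrite !modn_small // => /eqP.
have pi : p n.-1 = r i.
  have E : i.+1 + n.-1 = i + n by lia.
  by rewrite /p E modnDr modn_small.
have lp0 : lev (p 0) = 0 by apply: r_lev.
have ltD : #|colored f| < K by lia.
have [|q [[lq injq pq cq] qD p0q _]] := branch (_ : lev (p 0) <= 2) ltD.
  by rewrite lp0.
rewrite lp0 in lq.
have a4 : a < 4 by apply: leq_trans (ltn_ord a) k4.
apply: (@bob_even_path f p n.-1 q a) => //.
- split=> [j jm|j j' jm j'm|j jm].
  + split; last by rewrite r_lev.
    apply: fj => //; apply/negP => /eqP E.
    by have : j = n.-1 by [apply: inj; [lia|lia|rewrite pi /p E]]; lia.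
  + by apply: inj; lia.
  + by rewrite /p addnS; apply: r_edge.
- by lia.
- by rewrite n1_even.
- by rewrite lp0.
- split=> //; split=> // j jm.
  by split; [have := qD j jm; rewrite inE negbK => /eqP|rewrite lq].
- by rewrite lq //; lia.
- move=> j j' jm j'm E; have := lq _ j'm; rewrite -E r_lev //.
- exact: sees_Some p0 fi.
- exact: sees_Some p1 fi.
- by lia.
Qed.

Lemma alice_cycle f : Defs.proper e f -> #|colored f| <= 4 ->
  (forall i, i < n -> f (r i) = None) ->
  (forall f', legal_move e f f' -> (forall i, i < n -> f' (r i) = None) ->
     bob_wins e false f') ->
  bob_wins e true f.
Proof.
move=> pf cf un H; have n0 : 0 < n by lia.
apply: (alice_turn k4 (un 0 n0)) => f' v a lf fv f'v a4 eqf nsa sa.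
have cf' := card_colored_legal lf.
case: (boolP (v \in pset r n)) => [/imsetP[[i im] /= _ vE]|vr].
  rewrite vE in f'v eqf; apply: (bob_hit (legal_proper lf) im f'v) => //.
    by move=> j jm /eqP ji; rewrite eqf ?un // => /(r_inj jm im).
  by lia.
apply: H => // i im; rewrite eqf ?un // => E.
by rewrite -E mem_pset in vr.
Qed.

Lemma bob_wins_start : bob_wins e true ([ffun=> None] : partial_coloring T k).
Proof.
have n0 : 0 < n by lia.
have cX := card_pset r n.
have step f c : Defs.proper e f -> #|colored f| <= 3 ->
    (forall i, i < n -> f (r i) = None) ->
    (forall f', Defs.proper e f' -> (forall i, i < n -> f' (r i) = None) ->
       #|colored f'| = #|colored f|.+2 -> sees e f' (r 0) c ->
       (forall b, sees e f (r 0) b -> sees e f' (r 0) b) ->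
       bob_wins e false f') ->
    bob_wins e false f.
  move=> pf cf un H; apply: (@mark f (r 0) c (pset r n)) => //.
  - exact: un.
  - by rewrite r_lev.
  - exact: mem_pset.
  - by lia.
  move=> f1 lf1 s1 eqf1; have cf1 := card_colored_legal lf1.
  apply: (alice_cycle (legal_proper lf1)); first by lia.
    by move=> i im; rewrite eqf1 ?un // mem_pset.
  move=> f2 lf2 un2; apply: H => //.
  - exact: legal_proper lf2.
  - by rewrite (card_colored_legal lf2) cf1.
  - exact: sees_legal lf2 s1.
  - by move=> b sb; apply: sees_legal lf2 (sees_legal lf1 sb).
have cf0 : #|colored ([ffun=> None] : partial_coloring T k)| = 0.
  by apply: eq_card0 => x; rewrite !inE ffunE.
apply: alice_cycle => [x y a b _||i _|f lf un]; rewrite ?ffunE ?cf0 //.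
have cf : #|colored f| = 1 by rewrite (card_colored_legal lf) cf0.
apply: (step f 0 (legal_proper lf)) => //; first by rewrite cf.
move=> f2 pf2 un2 cf2 s0 _; rewrite cf in cf2.
apply: (step f2 1 pf2) => //; first by rewrite cf2.
move=> f3 pf3 un3 cf3 s1 s3; rewrite cf2 in cf3.
apply: (@bob_lollipop2 0 f3 r 0 1) => //.
- split=> //; split=> // i im; by rewrite un3 ?r_lev.
- by lia.
- exact: s3.
Qed.

End Strategy.

(** * Alice's strategy with five colors *)

Section Region.
Variables (T : finType) (e : rel T) (k : nat).
Variable I : bool -> partial_coloring T k -> Prop.
Hypotheses (I0 : I true [ffun=> None])
  (I_alice : forall f, I true f ->
     complete f \/ exists f', legal_move e f f' /\ I false f')
  (I_bob : forall f f', I false f -> legal_move e f f' -> I true f')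
  (I_bob_move : forall f, I false f ->
     complete f \/ exists f', legal_move e f f').

Lemma alice_wins_invariant : alice_wins e k.
Proof.
pose good f f' := legal_move e f f' /\ I false f'.
exists (fun f => epsilon (inhabits f) (good f)).
have gP f f' : I true f -> legal_move e f f' ->
    good f (epsilon (inhabits f) (good f)).
  move=> If [v [a [fv _ _]]]; apply: epsilon_spec.
  by case: (I_alice If) => [/(_ v)|//]; rewrite fv.
have reached_I alice f :
    reached e (fun f => epsilon (inhabits f) (good f)) alice f -> I alice f.
  elim=> [//|al {}f f' _ If [lf]]; case: al If => [If /(_ isT) f'E|If _];
    last exact: I_bob If lf.
  by have [_] := gP _ _ If lf; rewrite -f'E.
move=> [] f /reached_I If nost.
  case: (I_alice If) => // - [f' [lf _]].
  have gf := gP _ _ If lf.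
  by case: (nost (epsilon (inhabits f) (good f))); split=> //; case: gf.
by case: (I_bob_move If) => // - [f' lf]; case: (nost f').
Qed.

End Region.

Section Activation.
Variables (T : finType) (e : rel T) (par mate : T -> option T) (rk : T -> nat).
Hypotheses (e_par : forall x y, e x y ->
    [\/ par x = Some y, par y = Some x | mate x = Some y])
  (e_sym : symmetric e) (e_irr : irreflexive e)
  (rk_par : forall x y, par x = Some y -> rk y < rk x).
Implicit Types (A : {set T}) (v : T).

Definition children v : {set T} := [set x | par x == Some v].

Definition par_closed A := forall x y, x \in A -> par x = Some y -> y \in A.

Lemma activate (P : pred T) b A :
  par_closed A -> (forall v, P v -> #|children v :&: A| <= 1) ->
  exists A' u, [/\ [/\ b \in A', A \subset A' & par_closed A'],
    forall x, x \in A' -> x \notin A -> rk x <= rk b,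
    forall v, P v -> v <> u -> #|children v :&: A'| <= 1
  & forall v, P v -> #|children v :&: A'| <= 2].
Proof.
move=> clA chA.
have [m] := ubnP (rk b); elim: m b => // m IHm b ltm.
case: (boolP (b \in A)) => bA.
  exists A, b; split=> // [x xA|v Pv _|v Pv]; [by rewrite xA|exact: chA|].
  by apply: leq_trans (chA v Pv) _.
have add A' v : par b <> Some v -> children v :&: (b |: A') = children v :&: A'.
  move=> bv; apply/setP=> x; rewrite !inE.
  by case: (x =P b) => [->|//]; move/eqP/negPf: bv => ->.
have addle A' v : #|children v :&: (b |: A')| <= #|children v :&: A'|.+1.
  apply: (leq_trans (subset_leq_card (_ : _ \subset b |: (children v :&: A')))).
    by apply/subsetP=> x; rewrite !inE; case: eqP => //=; case: (x == b); rewrite ?orbT.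
  by rewrite cardsU1; case: (_ \notin _); rewrite ?add1n.
case pb: (par b) => [v|]; last first.
  exists (b |: A), b; split=> //.
  - split=> //; [by rewrite !inE eqxx|exact: subsetUr|].
    move=> x y; rewrite !inE => /orP[/eqP->|xA xy]; first by rewrite pb.
    by rewrite (clA x) ?orbT.
  - by move=> x; rewrite !inE => /orP[/eqP->//|xA]; rewrite xA.
  - by move=> w Pw _; rewrite add ?pb //; apply: chA.
  - by move=> w Pw; rewrite add ?pb //; apply: leq_trans (chA w Pw) _.
have rkv := rk_par pb.
case: (boolP (v \in A)) => vA.
  exists (b |: A), v; split=> //.
  - split=> //; [by rewrite !inE eqxx|exact: subsetUr|].
    move=> x y; rewrite !inE => /orP[/eqP->|xA xy].
      by rewrite pb => -[<-]; rewrite vA orbT.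
    by rewrite (clA x) ?orbT.
  - by move=> x; rewrite !inE => /orP[/eqP->//|xA]; rewrite xA.
  - by move=> w Pw wv; rewrite add; [exact: chA|rewrite pb => -[] /esym].
  - by move=> w Pw; apply: leq_trans (addle A w) _; apply: chA.
have [|A' [u [[vA' sA clA'] rA' ch1 ch2]]] := IHm v; first by lia.
have ch0 : children v :&: A' = set0.
  apply/setP=> x; rewrite !inE; apply/negP => /andP[/eqP xv xA'].
  have xA : x \notin A by apply: contra vA => /clA; apply.
  by have := rA' x xA' xA; have := rk_par xv; lia.
exists (b |: A'), u; split=> //.
- split=> //; [by rewrite !inE eqxx|exact: subset_trans sA (subsetUr _ _)|].
  move=> x y; rewrite !inE => /orP[/eqP->|xA xy].
    by rewrite pb => -[<-]; rewrite vA' orbT.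
  by rewrite (clA' x) ?orbT.
- move=> x; rewrite !inE => /orP[/eqP->//|xA' xA].
  by have := rA' x xA' xA; lia.
- move=> w Pw wu; have [->|wv] := eqVneq w v.
    by apply: leq_trans (addle A' v) _; rewrite ch0 cards0.
  by rewrite add; [exact: ch1|rewrite pb => -[] E; rewrite E eqxx in wv].
- move=> w Pw; have [->|wv] := eqVneq w v.
    by apply: leq_trans (addle A' v) _; rewrite ch0 cards0.
  by rewrite add; [exact: ch2|rewrite pb => -[] E; rewrite E eqxx in wv].
Qed.

Implicit Types f : partial_coloring T 5.

Lemma free_color f v (A : {set T}) : Defs.proper e f -> f v = None ->
  colored f \subset A -> #|children v :&: A| <= 2 ->
  exists a : 'I_5, legal_move e f [ffun x => if x == v then Some a else f x].
Proof.
move=> pf fv fA ch.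
pose N := [set x | e v x && (f x != None)].
have cN : #|N| <= 4.
  pose opt (o : option T) : {set T} := [set x | o == Some x].
  have opt1 o : #|opt o| <= 1.
    case: o => [x|]; last by rewrite eq_card0 // => x; rewrite !inE.
    rewrite -(cards1 x); apply: subset_leq_card; apply/subsetP=> y.
    by rewrite !inE => /eqP[->].
  have : N \subset opt (par v) :|: opt (mate v) :|: (children v :&: A).
    apply/subsetP=> x; rewrite !inE => /andP[/e_par vx fx].
    have xA : x \in A by apply: (subsetP fA); rewrite inE.
    by case: vx => ->; rewrite eqxx ?orbT // xA orbT.
  move/subset_leq_card/leq_trans; apply.
  have := (leq_card_setU (opt (par v) :|: opt (mate v)) (children v :&: A)).1.
  have := (leq_card_setU (opt (par v)) (opt (mate v))).1.
  by have := opt1 (par v); have := opt1 (mate v); lia.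
pose C := [set odflt ord0 (f x) | x in N].
have [a aC] : exists a, a \notin C.
  apply/existsP; rewrite -negb_forall; apply/negP => /forallP al.
  have : #|C| <= 4 by apply: leq_trans (leq_imset_card _ _) cN.
  have -> : C = setT by apply/setP=> a; rewrite al inE.
  by rewrite cardsT card_ord.
have nb x b : e v x -> f x = Some b -> b <> a.
  move=> vx fx ba; move/negP: aC; apply; apply/imsetP; exists x.
    by rewrite inE vx fx.
  by rewrite fx.
exists a, v, a; split=> // x y b d xy; rewrite !ffunE.
case: eqP => xv; case: eqP => yv.
- by rewrite xv yv e_irr in xy.
- by move=> [<-] fy ad; apply: (nb y d) => //; rewrite -xv.
- by move=> fx [<-]; apply: (nb x b) => //; rewrite -yv e_sym.
- exact: pf.
Qed.

(* A is the set of active vertices; on Alice's turn, u is the only uncolored vertex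
   that may have two active children. *)
Definition active (alice : bool) f : Prop :=
  Defs.proper e f /\ exists A (u : option T), [/\ colored f \subset A, par_closed A,
    forall v, f v = None -> alice ==> (Some v != u) -> #|children v :&: A| <= 1
  & forall v, f v = None -> #|children v :&: A| <= 2].

Lemma alice_wins5 : alice_wins e 5.
Proof.
apply: (@alice_wins_invariant _ _ _ active).
- split; first by move=> x y a b _; rewrite ffunE.
  exists set0, None; split=> [|x y|v|v]; rewrite ?inE ?setI0 ?cards0 //.
  by apply/subsetP=> x; rewrite !inE ffunE.
- move=> f [pf [A [u [fA clA ch1 ch2]]]].
  have move_at v A' : f v = None -> colored f \subset A' -> v \in A' ->
      par_closed A' -> (forall w, f w = None -> #|children w :&: A'| <= 2) ->
      (forall w, f w = None -> w != v -> #|children w :&: A'| <= 1) ->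
      exists f', legal_move e f f' /\ active false f'.
    move=> fv fA' vA' clA' le2 le1.
    have [a lf] := free_color pf fv fA' (le2 v fv).
    eexists; split; first exact: lf.
    split; first by case/legal_moveP: lf => ? [? []].
    exists A', None; split=> //.
    - apply/subsetP=> x; rewrite inE ffunE; case: (x =P v) => [->//|_ fx].
      by apply: (subsetP fA'); rewrite inE.
    - by move=> w; rewrite ffunE; case: (w =P v) => // /eqP wv fw _; apply: le1.
    - by move=> w; rewrite ffunE; case: (w =P v) => // _; apply: le2.
  case: (boolP [exists v, (f v == None) && (1 < #|children v :&: A|)]).
    case/existsP=> v /andP[/eqP fv ch_v].
    have uv : Some v == u.
      by apply/negPn/negP => uv; have := ch1 v fv uv; lia.
    right; apply: (move_at v A) => //.
      have [E|[x]] := set_0Vmem (children v :&: A).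
        by rewrite E cards0 in ch_v.
      by rewrite !inE => /andP[/eqP xv xA]; apply: clA xA xv.
    move=> w fw wv; apply: ch1 => //=; rewrite -(eqP uv).
    by apply: contra wv => /eqP[->].
  rewrite negb_exists => /forallP le1.
  have {}le1 w : f w = None -> #|children w :&: A| <= 1.
    by move=> fw; have := le1 w; rewrite fw eqxx -leqNgt.
  case: (pickP [pred v | f v == None]) => [v0 fv0|no]; last first.
    by left=> x fx; have := no x; rewrite /= fx.
  case: (arg_minnP rk fv0) => v /eqP fv minv; right.
  have cpar w : par v = Some w -> w \in A.
    move=> vw; apply: (subsetP fA); rewrite inE; apply/negP => fw.
    by have := minv w fw; have := rk_par vw; lia.
  have chv w : f w = None -> children w :&: (v |: A) = children w :&: A.
    move=> fw; apply/setP=> x; rewrite !inE; case: (x =P v) => [->|//] /=.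
    case: (par v =P Some w) => //= vw.
    by have := minv w; rewrite /= fw => /(_ erefl); have := rk_par vw; lia.
  apply: (move_at v (v |: A)) => //.
  - exact: subset_trans fA (subsetUr _ _).
  - by rewrite !inE eqxx.
  - move=> x y; rewrite !inE => /orP[/eqP->|xA xy]; last by rewrite (clA x) ?orbT.
    by move/cpar->; rewrite orbT.
  - by move=> w fw; rewrite chv // ltnW // ltnS le1.
  - by move=> w fw _; rewrite chv // le1.
- move=> f f' [pf [A [u [fA clA ch1 ch2]]]] lf.
  have [b [a [fb f'b eqf pf']]] := legal_moveP lf; split=> //.
  have [A' [w [[bA' sA clA'] _ le1 le2]]] :=
    @activate [pred v | f v == None] b A clA (fun v fv => ch1 v (eqP fv) isT).
  have f'None v : f' v = None -> f v = None.
    by move=> f'v; case fv: (f v) => [c|//]; rewrite (legal_move_Some lf fv) in f'v.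
  exists A', (Some w); split=> //.
  - apply/subsetP=> x; rewrite inE; have [->//|xb] := eqVneq x b.
    by rewrite eqf // => fx; apply: (subsetP sA); apply: (subsetP fA); rewrite inE.
  - move=> v /f'None fv /= vw; apply: le1; first by rewrite /= fv.
    by move=> E; rewrite E eqxx in vw.
  - by move=> v /f'None fv; apply: le2; rewrite /= fv.
- move=> f [pf [A [u [fA clA ch1 ch2]]]].
  case: (pickP [pred v | f v == None]) => [v /eqP fv|no]; last first.
    by left=> x fx; have := no x; rewrite /= fx.
  have [a lf] := free_color pf fv fA (ch2 v fv).
  by right; eexists; exact: lf.
Qed.

End Activation.

(** * The cactus *)

Lemma seq_argmax (V : eqType) (w : V -> nat) (s : seq V) : s != [::] ->
  exists2 x, x \in s & forall y, y \in s -> w y <= w x.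
Proof.
elim: s => // x s IH _; have [->|/IH[y ys my]] := eqVneq s [::].
  by exists x => [|y]; rewrite ?inE // => /eqP->.
have [le|lt] := leqP (w y) (w x).
  exists x => [|z]; rewrite inE ?eqxx // => /orP[/eqP->//|/my zy].
  exact: leq_trans le.
by exists y => [|z]; rewrite inE ?ys ?orbT // => /orP[/eqP->|/my//]; exact: ltnW.
Qed.

Lemma next_closed (V : eqType) (c : seq V) (P : pred V) x : uniq c -> x \in c ->
  P x -> (forall y, y \in c -> P y -> P (next c y)) -> forall y, y \in c -> P y.
Proof.
move=> un xc Px cl; have [i p E] := rot_to xc.
have: fcycle (next c) (rot i c) by rewrite rot_cycle cycle_next.
suff al q z : z \in c -> P z -> fpath (next c) z q -> all P (z :: q).
  rewrite E /= rcons_path => /andP[/(al _ _ xc Px)/allP pP _] y yc.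
  by apply: pP; rewrite -E mem_rot.
elim: q z => [|y q IH] z zc Pz /=; first by rewrite Pz.
move=> /andP[/eqP <- pq]; rewrite Pz; apply: IH => //; first by rewrite mem_next.
exact: cl.
Qed.

Lemma next_neq_prev (V : eqType) (c : seq V) x : uniq c -> 2 < size c ->
  x \in c -> next c x != prev c x.
Proof.
move=> un sz xc; have [i p E] := rot_to xc.
rewrite -(next_rot i un) -(prev_rot i un).
move: un sz; rewrite -(rot_uniq i) -(size_rot i) E.
case: p {E} => [|y [|z s]] // un _.
have -> : next [:: x, y, z & s] x = y by rewrite /= eqxx.
apply/eqP => yE; have := next_prev un x; rewrite -yE.
move: un; rewrite /= !inE !negb_or => /and3P[/and3P[xy xz _] _ _].
by rewrite [y == x]eq_sym (negPf xy) eqxx => /eqP; rewrite eq_sym (negPf xz).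
Qed.

Section Graph.
Variables (l n : nat).
Hypothesis n3 : 2 < n.
Let N := l + n.

Notation vtx := (seq (nat * nat) * nat)%type.
Implicit Types (x y : vtx) (a : seq (nat * nat)).

(* (a, t) is the t-th vertex of the lollipop with address a; the lollipop
   (i, j) :: a is the j-th one attached to the vertex (a, i). *)
Definition up x : option vtx :=
  match x with
  | (a, t.+1) => Some (a, t)
  | (p :: a, 0) => Some (a, p.1)
  | ([::], 0) => None
  end.

Definition chord x : option vtx :=
  if x.2 == l then Some (x.1, N.-1)
  else if x.2 == N.-1 then Some (x.1, l) else None.

Definition adj x y : bool :=
  [|| up x == Some y, up y == Some x | chord x == Some y].

Lemma upP x y : up x = Some y ->
  (x.1 = y.1 /\ x.2 = y.2.+1) \/ (x.2 = 0 /\ exists j, x.1 = (y.2, j) :: y.1).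
Proof.
case: x => -[|[i j] a] [|t] //= [<-]; [by left| |by left].
by right; split=> //; exists j.
Qed.

Lemma chordP x y : chord x = Some y -> x.1 = y.1 /\
  ((x.2 = l /\ y.2 = N.-1) \/ (x.2 = N.-1 /\ y.2 = l)).
Proof.
rewrite /chord; case: (x.2 =P l) => [xl|_]; first by move=> [<-]; split=> //; left.
by case: (x.2 =P N.-1) => // xN [<-]; split=> //; right.
Qed.

Lemma chord_sym x y : chord x = Some y -> chord y = Some x.
Proof.
case: x y => [a t] [b u] /chordP/= [-> [[-> ->]|[-> ->]]].
  by rewrite /chord /=; case: eqP => [|_]; rewrite ?eqxx //; lia.
by rewrite /chord /= eqxx.
Qed.

Lemma adj_sym : symmetric adj.
Proof.
move=> x y; rewrite /adj orbCA; congr [|| _, _ | _].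
by apply/eqP/eqP; apply: chord_sym.
Qed.

Lemma adjP x y : adj x y -> [\/ up x = Some y, up y = Some x | chord x = Some y].
Proof. by case/or3P => /eqP; [constructor 1|constructor 2|constructor 3]. Qed.

Lemma adj_irr : irreflexive adj.
Proof.
case=> a t; apply/negP => /adjP[/upP|/upP|/chordP]/=; last by lia.
  by move=> [[_]|[_ [j /(congr1 size)/=]]]; lia.
by move=> [[_]|[_ [j /(congr1 size)/=]]]; lia.
Qed.

(* In the deepest lollipop met by c, no vertex of c has a child outside of this
   lollipop, so c has to run along its cycle. *)
Lemma cycle_block (c : seq vtx) : cycle adj c -> uniq c -> 2 < size c ->
  (forall x, x \in c -> x.2 < N) ->
  exists a, (forall x, (x \in c) = (x.1 == a) && (l <= x.2 < N)) /\
    forall x y, x \in c -> y \in c -> adj x y -> y = next c x \/ y = prev c x.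
Proof.
move=> cy un sz ltN.
have c0 : c != [::] by case: (c) sz.
pose nb x y := (y == next c x) || (y == prev c x).
have nb_sym x y : x \in c -> nb x y -> nb y x.
  by move=> xc /orP[]/eqP->; rewrite /nb ?prev_next ?next_prev ?eqxx ?orbT.
have nb_mem x y : x \in c -> nb x y -> y \in c.
  by move=> xc /orP[]/eqP->; rewrite ?mem_next ?mem_prev.
have two x y z : x \in c ->
    (forall w, w \in c -> adj x w -> w = y \/ w = z) -> nb x y /\ nb x z.
  move=> xc H; have neq := next_neq_prev un sz xc.
  have := H (next c x); rewrite mem_next => /(_ xc (next_cycle cy xc)).
  have := H (prev c x); rewrite mem_prev adj_sym => /(_ xc (prev_cycle cy xc)).
  rewrite /nb => -[] E1 [] E2; move: neq; rewrite E1 E2 ?eqxx ?orbT //.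
have [v vc vmax] := seq_argmax (fun x : vtx => size x.1 * N + x.2) c0.
case: v vc vmax => a t /= vc vmax.
have tN := ltN _ vc; rewrite /= in tN.
have lev_max x : x \in c -> size x.1 <= size a.
  move=> xc; rewrite leqNgt; apply/negP => lt.
  have h1 := vmax x xc; have h2 : (size a).+1 * N <= size x.1 * N.
    by rewrite leq_mul2r lt orbT.
  move: h1 h2; rewrite mulSn /=.
  by move: (size x.1 * N) (size a * N) => A B; clear -tN; lia.
have t_max s : (a, s) \in c -> s <= t by move/vmax => /=; lia.
have nbrs s y : (a, s) \in c -> y \in c -> adj (a, s) y ->
    [\/ up (a, s) = Some y, y = (a, s.+1) | chord (a, s) = Some y].
  move=> sc yc /adjP[|/upP[/=[E1 E2]|[/= _ [j E]]]|]; try by constructor.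
    by constructor 2; case: y E1 E2 {yc} => b u /= -> ->.
  by have := lev_max y yc; rewrite E /=; lia.
have tE : t = N.-1.
  have [|no] := eqVneq t N.-1; first by [].
  have ch y : y \in c -> chord (a, t) <> Some y.
    rewrite /chord /= (negPf no); case: eqP => // tl yc [E].
    by have := t_max N.-1; rewrite E => /(_ yc); lia.
  have ne := next_neq_prev un sz vc.
  have up1 y : y \in c -> adj (a, t) y -> up (a, t) = Some y.
    move=> yc /(nbrs _ _ vc yc)[//|E|/ch//].
    by have := t_max t.+1; rewrite -E => /(_ yc); lia.
  have := up1 _ _ (next_cycle cy vc); rewrite mem_next => /(_ vc) E1.
  have := up1 (prev c (a, t)); rewrite mem_prev adj_sym => /(_ vc (prev_cycle cy vc)).
  by rewrite E1 => -[E]; rewrite E eqxx in ne.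
have inner s : l < s < N -> (a, s) \in c ->
    nb (a, s) (a, s.-1) /\ nb (a, s) (if s == N.-1 then (a, l) else (a, s.+1)).
  move=> /andP[ls sN] sc; apply: two => // w wc /(nbrs _ _ sc wc)[].
  - by case/upP => /= -[E1 E2]; [left; case: (w) E1 E2 => b u /= -> ->|lia].
  - by move=> E; have := ltN _ wc; rewrite E /= => sN'; right; case: (s =P N.-1) => //; lia.
  - by rewrite /chord /= gtn_eqF //; case: (s =P N.-1) => // _ [<-]; right.
have block s : l <= s < N -> (a, s) \in c.
  move=> /andP[ls sN]; rewrite -(subKn (_ : s <= N.-1)); last by lia.
  have : N.-1 - s <= N.-1 - l by lia.
  elim: (N.-1 - s) => [_|i IH il].
    by rewrite subn0 -tE.
  have [|nbi _] := inner (N.-1 - i) _ (IH (ltnW il)); first by lia.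
  have := nb_mem _ _ (IH (ltnW il)) nbi.
  by have -> : (N.-1 - i).-1 = N.-1 - i.+1 by lia.
have chord_nb : nb (a, N.-1) (a, l).
  by have [||_] := inner N.-1; [lia|apply: block; lia|rewrite eqxx].
have up_nb s : l <= s -> s.+1 < N -> nb (a, s.+1) (a, s).
  by move=> ls sN; have [||] := inner s.+1; [lia|apply: block; lia|].
have next_in x y z : nb x y -> nb x z -> y <> z -> next c x = y \/ next c x = z.
  by move=> /orP[]/eqP-> /orP[]/eqP->; auto.
have inblock x : x \in c -> (x.1 == a) && (l <= x.2 < N).
  apply: (@next_closed _ c [pred y : vtx | (y.1 == a) && (l <= y.2 < N)] _ un vc) => /=.
    by rewrite eqxx; lia.
  case=> b s /= sc /and3P[/eqP E ls sN]; move: sc; rewrite {}E => sc.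
  have [sl|sl] := eqVneq s l.
    have nb1 : nb (a, s) (a, N.-1).
      by apply: nb_sym; rewrite ?sl //; apply: block; lia.
    have nb2 : nb (a, s) (a, l.+1).
      by apply: nb_sym; [apply: block|rewrite sl; apply: up_nb]; lia.
    have [||] := next_in _ _ _ nb1 nb2; first by case; lia.
      by move=> ->; rewrite /= eqxx; lia.
    by move=> ->; rewrite /= eqxx; lia.
  have [||nb1 nb2] := inner s; [lia|by []|].
  have [||] := next_in _ _ _ nb1 nb2; first by case: ifP => [/eqP sE|_] []; lia.
    by move=> ->; rewrite /= eqxx; lia.
  by move=> ->; case: ifP => sE /=; rewrite eqxx; lia.
exists a; split=> [x|[b s] [b' u]].
  apply/idP/idP; first exact: inblock.
  by case: x => b s /= /andP[/eqP-> /block].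
move=> xc yc; have /= /and3P[/eqP Eb ls sN] := inblock _ xc.
have /= /and3P[/eqP Eb' lu uN] := inblock _ yc.
rewrite {}Eb {}Eb' in xc yc *; move=> xy.
suff: nb (a, s) (a, u) by case/orP => /eqP; auto.
case: (adjP xy) => [/upP|/upP|/chordP] /=.
- by case=> [[_ E]|[_ [j /(congr1 size)/=]]]; [rewrite E in sN *; apply: up_nb|lia].
- case=> [[_ E]|[_ [j /(congr1 size)/=]]]; last by lia.
  by apply: nb_sym => //; rewrite E in uN *; apply: up_nb.
- by case=> _ [[-> ->]|[-> ->]] //; apply: nb_sym => //; apply: block; lia.
Qed.

(* How far along the handle of the lollipop a the vertex (b, t) is, or the vertex
   of a through which (b, t) is attached to a. *)
Fixpoint depth_in a b t : nat :=
  if b == a then minn t l else if b is p :: b' then depth_in a b' p.1 else 0.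

Lemma depth_in_eq0 a b t : size b <= size a -> b != a -> depth_in a b t = 0.
Proof.
elim: b t => [|p b IH] t /= le ne; rewrite (negPf ne) // IH //; first exact: ltnW.
by apply: contraTneq le => ->; rewrite ltnn.
Qed.

Lemma depth_in_adj a x y : adj x y -> depth_in a x.1 x.2 <= (depth_in a y.1 y.2).+1.
Proof.
have same b t u : t <= u.+1 -> depth_in a b t <= (depth_in a b u).+1.
  by move=> tu; case: b => [|p b] /=; case: eqP; lia.
have attach p b : depth_in a (p :: b) 0 = depth_in a b p.1.
  rewrite /=; case: eqP => // <-.
  by rewrite depth_in_eq0 ?min0n //=; apply/eqP => /(congr1 size) /=; lia.
case: x y => [b t] [b' u] /adjP[/upP|/upP|/chordP] /=.
- case=> [[-> ->]|[-> [j ->]]]; first exact: same.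
  by rewrite attach.
- case=> [[-> ->]|[-> [j ->]]]; first by apply: same; lia.
  by rewrite attach /=; lia.
- move=> [-> H]; case: b' => [|p b'] /=; case: eqP; lia.
Qed.

Lemma depth_in_path a x p : path adj x p ->
  depth_in a x.1 x.2 <= depth_in a (last x p).1 (last x p).2 + size p /\
  depth_in a (last x p).1 (last x p).2 <= depth_in a x.1 x.2 + size p.
Proof.
elim: p x => [|y p IH] x /=; first by lia.
case/andP=> xy /IH; have := depth_in_adj a xy.
by rewrite adj_sym in xy; have := depth_in_adj a xy; lia.
Qed.

Lemma blocks_far a b t u p : a <> b -> l <= t -> l <= u -> path adj (a, t) p ->
  last (a, t) p = (b, u) -> l <= size p.
Proof.
move=> ab lt lu pp lastp.
have top c s : l <= s -> depth_in c c s = l.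
  by case: c => [|p' c] /= ls; rewrite ?eqxx /=; lia.
have [le|/ltnW le] := leqP (size a) (size b).
  have [_] := depth_in_path b pp; rewrite lastp /= top // depth_in_eq0 //.
  exact/eqP.
have [+ _] := depth_in_path a pp; rewrite lastp /= top // depth_in_eq0 //.
by apply/eqP => /esym.
Qed.

Variable K : nat.

Definition valid x : bool :=
  [&& size x.1 <= 3, all (fun p => (p.1 < N) && (p.2 < K)) x.1 & x.2 < N].

Fixpoint addresses d : seq (seq (nat * nat)) :=
  if d is d'.+1 then
    [::] :: [seq p :: a | p <- allpairs pair (iota 0 N) (iota 0 K), a <- addresses d']
  else [:: [::]].

Lemma mem_addresses d a : (a \in addresses d) =
  (size a <= d) && all (fun p => (p.1 < N) && (p.2 < K)) a.
Proof.
elim: d a => [|d IH] [|p a] //=.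
rewrite inE /= ltnS; apply/allpairsP/idP => [[[q b] /= [qs bs [-> ->]]]|].
  rewrite IH in bs; case/andP: bs => -> ->; rewrite andbT /=.
  by case/allpairsP: qs => -[i j] /=; rewrite !mem_iota => -[? ? ->]; apply/andP.
move=> /andP[sa /andP[/andP[p1 p2] al]]; exists (p, a); split=> //=.
  by apply/allpairsP; exists p; rewrite !mem_iota; split=> //; case: (p).
by rewrite IH sa.
Qed.

Definition vertices : seq vtx := allpairs pair (addresses 3) (iota 0 N).

Lemma mem_vertices x : (x \in vertices) = valid x.
Proof.
apply/allpairsP/idP => [[[a t] [aS tS ->]]|].
  by move: aS tS; rewrite mem_addresses mem_iota /valid => /andP[-> ->].
rewrite /valid => /and3P[sx al x2]; exists x; split; last by case: (x).
  by rewrite mem_addresses sx.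
by rewrite mem_iota.
Qed.

Definition vertex : finType := seq_sub vertices.

Definition edge (x y : vertex) : bool := adj (val x) (val y).

Lemma vertexP (x : vertex) : valid (val x).
Proof. by rewrite -mem_vertices; apply: valP. Qed.

Lemma val_insubd_vertex (x0 : vertex) x : valid x -> val (insubd x0 x) = x.
Proof. by rewrite -mem_vertices => vx; rewrite insubdK. Qed.

Lemma insub_SomeE x (y : vertex) : insub x = Some y -> val y = x.
Proof. by case: insubP => // z _ <- [->]. Qed.

Lemma edge_sym : symmetric edge. Proof. by move=> x y; apply: adj_sym. Qed.

Lemma edge_irr : irreflexive edge. Proof. by move=> x; apply: adj_irr. Qed.

Lemma edge_alice_wins5 : alice_wins edge 5.
Proof.
pose rank x := x.2 + sumn [seq p.1.+1 | p <- x.1].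
have insub_up (o : option vtx) (y : vertex) : o = Some (val y) ->
    obind insub o = Some y :> option vertex by move=> -> /=; rewrite valK.
refine (@alice_wins5 vertex edge (fun x : vertex => obind insub (up (val x)))
  (fun x : vertex => obind insub (chord (val x)))
  (fun x : vertex => rank (val x)) _ _ _ _).
- move=> x y /adjP[] E; [constructor 1|constructor 2|constructor 3]; exact: insub_up.
- exact: edge_sym.
- exact: edge_irr.
- move=> x y; case E: (up (val x)) => [z|//] /= /insub_SomeE yE.
  rewrite yE /rank /=; move: E => /=; case: (ssval x) => -[|p a] [|t] //= [<-] /=; lia.
Qed.

Lemma edge_branch (D : {set vertex}) (v : vertex) : size (val v).1 <= 2 -> #|D| < K ->
  exists q : nat -> vertex, [/\ [/\
        forall i, i < N -> size (val (q i)).1 = (size (val v).1).+1,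
        forall i j, i < N -> j < N -> q i = q j -> i = j,
        forall i, i.+1 < N -> edge (q i) (q i.+1)
      & edge (q l) (q N.-1)],
    forall i, i < N -> q i \notin D, edge v (q 0) &
    forall x : vertex, edge (q 0) x -> x = v \/ x \notin D].
Proof.
move=> sv ltD; have := vertexP v; case E: (val v) sv => [a t] /= sv.
rewrite /valid /= => /and3P[_ al tN].
pose branch_of (x : vertex) :=
  (nth (0, 0) (val x).1 (size (val x).1 - (size a).+1)).2.
have [j jK jD] : exists2 j, j < K & j \notin map branch_of (enum D).
  have : ~~ all (mem (map branch_of (enum D))) (iota 0 K).
    apply/negP => /allP sub; have := uniq_leq_size (iota_uniq 0 K) sub.
    by rewrite size_iota size_map -cardE leqNgt ltD.
  by rewrite -has_predC => /hasP[j]; rewrite mem_iota => jK jD; exists j.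
have vq i : i < N -> valid ((t, j) :: a, i).
  by move=> iN; rewrite /valid /= ltnS sv tN jK al iN.
pose q i := insubd v ((t, j) :: a, i).
have qE i : i < N -> val (q i) = ((t, j) :: a, i).
  by move=> iN; apply: val_insubd_vertex; apply: vq.
have notD (x : vertex) : branch_of x = j -> x \notin D.
  by move=> bx; apply: contra jD => xD; apply/mapP; exists x; rewrite ?mem_enum.
have N0 : 0 < N by rewrite /N; lia.
exists q; split; first split.
- by move=> i iN; rewrite qE.
- by move=> i i' iN i'N /(congr1 val); rewrite !qE // => -[].
- by move=> i iN; rewrite /edge !qE ?(ltnW iN) // /adj /= eqxx orbT.
- by rewrite /edge !qE ?/N; [rewrite /adj /chord /= eqxx !eqxx !orbT|lia|lia].
- by move=> i iN; apply: notD; rewrite /branch_of qE //= subnn.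
- by rewrite /edge E qE // /adj /= eqxx orbT.
move=> x; rewrite /edge qE // => /adjP[]/=.
- by case=> Ex; left; apply: val_inj; rewrite E.
- move=> /upP/= H; right; apply: notD; rewrite /branch_of.
  by case: H => [[-> _]|[_ [j' ->]]] /=; rewrite ?subnn ?subSS ?subSnn.
- by move=> /chordP/= [H _]; right; apply: notD; rewrite /branch_of -H /= subnn.
Qed.

Lemma root_proof : ([::], 0) \in vertices.
Proof. by rewrite mem_vertices /valid /= /N; lia. Qed.

Definition root : vertex := SeqSub root_proof.

Lemma edge_not_alice_wins j : odd n -> 6 * (l + n) + 2 * l + 6 * n + 80 < K ->
  j <= 4 -> ~ alice_wins edge j.
Proof.
move=> n_odd ltK j4 [s ws]; have start := reached_start edge s.
case: (posnP j) => [j0|j0].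
  apply: (ws _ _ start _ root); last by rewrite ffunE.
  by move=> f' [[v [a _]] _]; have := ltn_ord a; rewrite [X in _ < X]j0.
apply: (winning_not_bob_wins ws start).
pose r i := insubd root ([::], l + i).
have rE i : i < n -> val (r i) = ([::], l + i).
  by move=> lt_n; apply: val_insubd_vertex; rewrite /valid /= /N; lia.
apply: (@bob_wins_start _ _ _ j0 j4 edge_sym edge_irr
  (fun x : vertex => size (val x).1) K l n n_odd n3 edge_branch r) => //.
- by move=> i lt_n; rewrite rE.
- move=> i i' lt_n lt_n' /(congr1 val); rewrite !rE // => -[]; lia.
- by move=> i lt_n; rewrite /edge !rE ?(ltnW lt_n) // /adj /= addnS /= eqxx orbT.
- have nE : l + n.-1 = (l + n).-1 by lia.
  by rewrite /edge !rE ?/adj /chord /= ?addn0 ?nE ?eqxx ?orbT //; lia.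
Qed.

Definition in_block a (x : vertex) : bool := ((val x).1 == a) && (l <= (val x).2).

Lemma edge_cycle c : is_cycle edge c -> exists a,
  [/\ forall x : vertex, (x \in c) = in_block a x,
      cycle_edges c = [set s | [exists x : vertex, exists y : vertex,
        [&& in_block a x, in_block a y, edge x y & s == [set x; y]]]]
    & n <= size c].
Proof.
case/andP=> sz /andP[cy un].
have un' : uniq (map val c) by rewrite map_inj_uniq //; apply: val_inj.
have [|||x /mapP[z _ ->]|a [memE nbE]] := @cycle_block (map val c).
- by rewrite cycle_map.
- exact: un'.
- by rewrite size_map.
- by case/and3P: (vertexP z).
have mem_c (x : vertex) : (x \in c) = in_block a x.
  rewrite -(mem_map val_inj) memE /in_block.
  by case/and3P: (vertexP x) => _ _ ->; rewrite andbT.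
exists a; split=> //.
- apply/setP=> s; rewrite inE; apply/imsetP/existsP => [[x xc ->]|[x /existsP[y]]].
    exists x; apply/existsP; exists (next c x).
    by rewrite -!mem_c mem_next xc (next_cycle cy xc) eqxx.
  rewrite -!mem_c => /and4P[xc yc xy /eqP->].
  have := nbE (val x) (val y); rewrite !(mem_map val_inj) => /(_ xc yc xy).
  rewrite (next_map val_inj) // (prev_map val_inj) // => -[] /val_inj yE.
    by exists x; rewrite // yE.
  by exists y; rewrite // yE next_prev // setUC.
- rewrite -(size_map val) -[n](size_iota 0) -(size_map (fun i => (a, l + i))).
  apply: uniq_leq_size.
    by rewrite map_inj_uniq ?iota_uniq // => i j []; lia.
  move=> x /mapP[i]; rewrite mem_iota => lt_n ->; rewrite memE /= eqxx /N; lia.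
Qed.

Lemma edge_cactus : cactus edge.
Proof.
move=> x y c1 c2 xy cy1 cy2 xy1 xy2.
have [[a1 [m1 e1 _]] [a2 [m2 e2 _]]] := (edge_cycle cy1, edge_cycle cy2).
have mem_x (c : seq vertex) : [set x; y] \in cycle_edges c -> x \in c.
  case/imsetP=> z zc E; have: x \in [set z; next c z] by rewrite -E !inE eqxx.
  by rewrite !inE => /orP[]/eqP->; rewrite ?mem_next.
have aE : a1 = a2.
  have := mem_x _ xy1; have := mem_x _ xy2.
  by rewrite m1 m2 => /andP[/eqP<- _] /andP[/eqP<- _].
by rewrite e1 e2 aE.
Qed.

Lemma edge_cycles_far c1 c2 (x : vertex) (p : seq vertex) :
  is_cycle edge c1 -> is_cycle edge c2 ->
  cycle_edges c1 <> cycle_edges c2 -> x \in c1 -> last x p \in c2 ->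
  path edge x p -> l <= size p.
Proof.
move=> cy1 cy2 ne.
have [[a1 [m1 e1 _]] [a2 [m2 e2 _]]] := (edge_cycle cy1, edge_cycle cy2).
rewrite m1 m2 => /andP[/eqP Ex lx] /andP[/eqP Ep lp] pp.
have a12 : a1 <> a2 by move=> aE; apply: ne; rewrite e1 e2 aE.
rewrite -(size_map val); apply: (@blocks_far a1 a2 _ _ _ a12 lx lp).
  by rewrite -Ex -surjective_pairing path_map.
by rewrite -Ex -surjective_pairing last_map -Ep -surjective_pairing.
Qed.

End Graph.

Lemma is_minimum_exists (P : nat -> Prop) : exists m, is_minimum P m.
Proof.
have [[j Pj]|no] := classic (exists j, P j); last first.
  by exists None => j Pj; apply: no; exists j.
have [m] := ubnP j; elim: m j Pj => // m IH j Pj ltm.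
have [[i [Pi ij]]|no] := classic (exists i, P i /\ i < j).
  by apply: (IH i Pi); lia.
exists (Some j); split=> // i Pi; rewrite leqNgt; apply/negP => ij.
by apply: no; exists i.
Qed.

Lemma at_least_minimum (P : nat -> Prop) m (b : nat) (z : int) :
  is_minimum P m -> (forall j, P j -> b <= j) -> (z <= b%:Z)%R -> at_least m z.
Proof. by case: m => [j [Pj _]|//] /(_ j Pj) bj zb; rewrite /at_least; lia. Qed.

Theorem theorem1 (d k : int) :
  exists (T : finType) (e : rel T) (girth cycle_distance : option nat),
    [/\ simple_graph e /\ cactus e,
        is_girth e girth, at_least girth k,
        is_cycle_distance e cycle_distance /\ at_least cycle_distance d
      & is_game_chromatic_number e 5].
Proof.
pose l := `|d|%N; pose n := (`|k|%N).*2.+3.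
pose K := 6 * (l + n) + 2 * l + 6 * n + 81.
have n3 : 2 < n by [].
have n_odd : odd n by rewrite /n /= odd_double.
exists (vertex l n K), (@edge l n K).
have [g gP] := is_minimum_exists
  (fun m => exists2 c, is_cycle (@edge l n K) c & size c = m).
have [D DP] := is_minimum_exists (fun m => exists c1 c2 x p,
  [/\ is_cycle (@edge l n K) c1 /\ is_cycle (@edge l n K) c2,
      cycle_edges c1 <> cycle_edges c2, x \in c1 /\ last x p \in c2,
      path (@edge l n K) x p /\ uniq (x :: p) & size p = m]).
exists g, D; split=> //.
- split; last exact: edge_cactus.
  by split; [exact: edge_sym|exact: edge_irr].
- apply: (at_least_minimum gP (b := n)); last by rewrite /n; lia.
  by move=> j [c cy <-]; have [a []] := edge_cycle n3 cy.
- split=> //; apply: (at_least_minimum DP (b := l)); last by rewrite /l; lia.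
  move=> j [c1 [c2 [x [p [[cy1 cy2] ne [xc lc] [pp _] <-]]]]].
  exact: (edge_cycles_far n3 cy1 cy2 ne xc lc pp).
- split; first exact: edge_alice_wins5.
  move=> j aw; rewrite leqNgt; apply/negP => j4.
  have ltK : 6 * (l + n) + 2 * l + 6 * n + 80 < K by rewrite /K; lia.
  exact: (edge_not_alice_wins n3 n_odd ltK j4 aw).
Qed.
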